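(* Let $k$ be an algebraically closed field and let $\mathscr{C}$ be an essentially small $k$-linear, Hom-finite, Krull--Schmidt, 2-Calabi--Yau triangulated category. Let $\mathscr{T}$ and $\mathscr{U}$ be any two cluster tilting subcategories of $\mathscr{C}$, and let $u\in\mathrm{Indec}(\mathscr{U})$. (1) The $c$-vector of the pair $(u,\mathscr{U})$ with respect to $\mathscr{T}$ is given by $$c_{\mathscr{T}}(u,\mathscr{U})=[u]^*\circ\overline{\mathrm{ind}}_{\mathscr{U}}\big|_{K_0^{\mathrm{split}}(\mathscr{T})}.$$ (2) Assume in addition that the quiver of each cluster tilting subcategory of $\mathscr{C}$ is without loops and $2$-cycles. Let $u^*$ be the mutation of $u$ with respect to $\mathscr{U}$ and let $u^*\to e\to u\xrightarrow{\ \delta\ }\Sigma u^*$ be the exchange triangle. Then $c_{\mathscr{T}}(u,\mathscr{U})$ is positive (i.e. $\langle c_{\mathscr{T}}(u,\mathscr{U}),[t]\rangle\ge 0$ for all $t\in\mathrm{Indec}(\mathscr{T})$) if and only if $\delta\notin[\Sigma\mathscr{T}]$, and in this case $$c_{\mathscr{T}}(u,\mathscr{U})=\dim_{\mathscr{T}}\mathrm{Im}\Big(\mathrm{Hom}_{\mathscr{C}}(-,u)\big|_{\mathscr{T}}\to\mathrm{Hom}_{\mathscr{C}}(-,\Sigma u^* )\big|_{\mathscr{T}}\Big),$$ where the morphism is induced by $\delta$.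
   Context: The suspension functor of $\mathscr{C}$ is $\Sigma$. A cluster tilting subcategory of $\mathscr{C}$ is a full subcategory $\mathscr{T}$ (closed under isomorphisms) which is functorially finite (every object of $\mathscr{C}$ has a right and a left $\mathscr{T}$-approximation) and satisfies $\mathscr{T}=\{c\in\mathscr{C}\mid \mathrm{Hom}_{\mathscr{C}}(\Sigma^{-1}t,c)=0\ \forall t\in\mathscr{T}\}=\{c\in\mathscr{C}\mid \mathrm{Hom}_{\mathscr{C}}(c,\Sigma t)=0\ \forall t\in\mathscr{T}\}$. Its quiver has vertex set $\mathrm{Indec}(\mathscr{T})$ (isomorphism classes of indecomposables), and the number of arrows $x\to y$ is $\dim_k \mathrm{rad}_{\mathscr{T}}(x,y)/\mathrm{rad}^2_{\mathscr{T}}(x,y)$. $K_0^{\mathrm{split}}(\mathscr{T})$ is the split Grothendieck group, free abelian on $\{[t]\mid t\in\mathrm{Indec}(\mathscr{T})\}$. For an abelian group $A$, $A^*=\mathrm{Hom}(A,\mathbb{Z})$, and $\langle -,-\rangle$ is evaluation. For $t\in\mathrm{Indec}(\mathscr{T})$, $[t]^*\in K_0^{\mathrm{split}}(\mathscr{T})^*$ is given by $\langle[t]^*,[s]\rangle=\delta_{ts}$ for $s\in\mathrm{Indec}(\mathscr{T})$; similarly $[u]^*\in K_0^{\mathrm{split}}(\mathscr{U})^*$. For $s\in\mathscr{C}$ there is a distinguished triangle $t_1\to t_0\to s\to\Sigma t_1$ with $t_0,t_1\in\mathscr{T}$; the index is $\mathrm{ind}_{\mathscr{T}}(s)=[t_0]-[t_1]\in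 K_0^{\mathrm{split}}(\mathscr{T})$. This induces $\mathrm{ind}_{\mathscr{T}}:K_0^{\mathrm{split}}(\mathscr{C})\to K_0^{\mathrm{split}}(\mathscr{T})$. The index map in the opposite category is $\overline{\mathrm{ind}}_{\mathscr{U}}(c)=[u^0]-[u^1]$ for a distinguished triangle $c\to u^0\to u^1\to\Sigma c$ in $\mathscr{C}$ with $u^0,u^1\in\mathscr{U}$; it extends to a homomorphism $K_0^{\mathrm{split}}(\mathscr{C})\to K_0^{\mathrm{split}}(\mathscr{U})$. By a theorem of Dehy--Keller, $\{\mathrm{ind}_{\mathscr{T}}(v)\mid v\in\mathrm{Indec}(\mathscr{U})\}$ is a $\mathbb{Z}$-basis of $K_0^{\mathrm{split}}(\mathscr{T})$. The $c$-vector $c_{\mathscr{T}}(u,\mathscr{U})\in K_0^{\mathrm{split}}(\mathscr{T})^*$ is the unique element with $\langle c_{\mathscr{T}}(u,\mathscr{U}),\mathrm{ind}_{\mathscr{T}}(v)\rangle=\delta_{uv}$ for all $v\in\mathrm{Indec}(\mathscr{U})$. Mutation: for $u\in\mathrm{Indec}(\mathscr{U})$ there is a unique other isomorphism class of indecomposable $u^*\not\cong u$ such that $\mathrm{add}\big((\mathrm{Indec}(\mathscr{U})\setminus u)\cup u^*\big)$ is cluster tilting, and there is an exchange triangle $u^*\to e\to u\xrightarrow{\delta}\Sigma u^*$ in which $u^*\to e$ is a minimal left, and $e\to u$ a minimal right, $\mathrm{add}(\mathrm{Indec}(\mathscr{U})\setminus u)$-approximation. $[\Sigma\mathscr{T}]$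 is the ideal of morphisms of $\mathscr{C}$ factoring through an object of $\Sigma\mathscr{T}$. For a functor $M:\mathscr{T}^{\mathrm{op}}\to k\text{-}\mathrm{mod}$ ($k$-linear with finite dimensional values), $\dim_{\mathscr{T}}M\in K_0^{\mathrm{split}}(\mathscr{T})^*$ is given by $\langle\dim_{\mathscr{T}}M,[t]\rangle=\dim_kM(t)$. *)

(* Defs.v *)
From HB Require Import structures.
From mathcomp Require Import all_boot all_order all_algebra.
From mathcomp Require Import boolp classical_sets.
From mathcomp Require Import freeg.

Set Implicit Arguments.
Unset Strict Implicit.
Unset Printing Implicit Defensive.

Import GRing.Theory Num.Theory.
Local Open Scope classical_set_scope.
Local Open Scope ring_scope.

Reserved Notation "g \oc f" (at level 40, left associativity).

(* Hom spaces are [vectType]s, i.e. finite dimensional, so that Hom-finiteness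
   is part of the structure. *)
Record linear_category (k : fieldType) := LinearCategory {
  obj :> Type;
  mor : obj -> obj -> vectType k;
  idm : forall x, mor x x;
  mcomp : forall x y z, mor y z -> mor x y -> mor x z;
  comp_idl : forall x y (f : mor x y), mcomp (idm y) f = f;
  comp_idr : forall x y (f : mor x y), mcomp f (idm x) = f;
  comp_assoc : forall x y z w (h : mor z w) (g : mor y z) (f : mor x y),
    mcomp h (mcomp g f) = mcomp (mcomp h g) f;
  comp_linear_r : forall x y z (g : mor y z), linear (mcomp g : mor x y -> _);
  comp_linear_l : forall x y z (f : mor x y),
    linear ((fun g => mcomp g f) : mor y z -> mor x z)
}.

Arguments mor {k} {l} x y.
Arguments idm {k} {l} x.
Arguments mcomp {k} {l} {x y z} g f.
Arguments comp_idl {k l} [x y] f.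
Arguments comp_idr {k l} [x y] f.
Arguments comp_assoc {k l} [x y z w] h g f.
Arguments comp_linear_r {k l} x [y z] g.
Arguments comp_linear_l {k l} [x y] z f.

Notation "g \oc f" := (mcomp g f).

Section Linear.
Variables (k : fieldType) (C : linear_category k).
Implicit Types (x y z c : C).

HB.instance Definition _ x y z (g : mor y z) :=
  GRing.isLinear.Build k (mor x y) (mor x z) *:%R (mcomp g)
    (comp_linear_r x g).

Definition precomp z x y (f : mor x y) (g : mor y z) : mor x z := g \oc f.

HB.instance Definition _ x y z (f : mor x y) :=
  GRing.isLinear.Build k (mor y z) (mor x z) *:%R (precomp f)
    (comp_linear_l z f).

Definition is_iso x y (f : mor x y) : Prop :=
  exists2 g : mor y x, g \oc f = idm x & f \oc g = idm y.

Definition isomorphic x y : Prop := exists f : mor x y, is_iso f.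

Definition is_zero x : Prop := idm x = 0.

Definition is_biproduct x y c : Prop :=
  exists (i : mor x c) (j : mor y c) (p : mor c x) (q : mor c y),
    [/\ p \oc i = idm x, q \oc j = idm y, p \oc j = 0, q \oc i = 0 &
        i \oc p + j \oc q = idm c].

(* For [n = 0] this says that [c] is a zero object. *)
Definition is_dsum n (x : 'I_n -> C) c : Prop :=
  exists (i : forall j, mor (x j) c) (p : forall j, mor c (x j)),
    [/\ forall j, p j \oc i j = idm (x j),
        forall j l, j != l -> p j \oc i l = 0 &
        \sum_j i j \oc p j = idm c].

Definition indecomposable x : Prop :=
  ~ is_zero x /\ forall y z, is_biproduct y z x -> is_zero y \/ is_zero z.

Definition local_end x : Prop :=
  ~ is_zero x /\ forall f : mor x x, is_iso f \/ is_iso (idm x - f).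

Definition krull_schmidt : Prop :=
  forall c, exists n (x : 'I_n -> C),
    (forall j, local_end (x j)) /\ is_dsum x c.

End Linear.

Record endofunctor (k : fieldType) (C : linear_category k) := Endofunctor {
  fobj :> C -> C;
  fmap : forall x y, mor x y -> mor (fobj x) (fobj y);
  fmap_linear : forall x y, linear (@fmap x y);
  fmap_id : forall x, fmap (idm x) = idm (fobj x);
  fmap_comp : forall x y z (g : mor y z) (f : mor x y),
    fmap (g \oc f) = fmap g \oc fmap f
}.

Arguments fmap {k C} F [x y] f : rename.

(* The suspension [Sg] is an autoequivalence with quasi-inverse [SgV]. *)
Record triangulated_category (k : fieldType) := TriangulatedCategory {
  tcat :> linear_category k;
  tri_additive : forall n (x : 'I_n -> tcat), exists c, is_dsum x c;
  Sg : endofunctor tcat;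
  SgV : endofunctor tcat;
  SgVK : exists e : forall x, mor (Sg (SgV x)) x,
    (forall x, is_iso (e x)) /\
    (forall x y (f : mor x y), f \oc e x = e y \oc fmap Sg (fmap SgV f));
  SgK : exists e : forall x, mor (SgV (Sg x)) x,
    (forall x, is_iso (e x)) /\
    (forall x y (f : mor x y), f \oc e x = e y \oc fmap SgV (fmap Sg f));
  dtri : forall x y z, mor x y -> mor y z -> mor z (Sg x) -> Prop;
  dtri_iso : forall x y z (f : mor x y) (g : mor y z) (h : mor z (Sg x))
      x' y' z' (f' : mor x' y') (g' : mor y' z') (h' : mor z' (Sg x'))
      (a : mor x x') (b : mor y y') (c : mor z z'),
    is_iso a -> is_iso b -> is_iso c ->
    b \oc f = f' \oc a -> c \oc g = g' \oc b -> fmap Sg a \oc h = h' \oc c ->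
    dtri f g h -> dtri f' g' h';
  dtri_id : forall x z, is_zero z ->
    dtri (idm x) (0 : mor x z) (0 : mor z (Sg x));
  dtri_cone : forall x y (f : mor x y),
    exists z (g : mor y z) (h : mor z (Sg x)), dtri f g h;
  dtri_rot : forall x y z (f : mor x y) (g : mor y z) (h : mor z (Sg x)),
    dtri f g h <-> dtri g h (- fmap Sg f);
  dtri_fill : forall x y z (f : mor x y) (g : mor y z) (h : mor z (Sg x))
      x' y' z' (f' : mor x' y') (g' : mor y' z') (h' : mor z' (Sg x'))
      (a : mor x x') (b : mor y y'),
    dtri f g h -> dtri f' g' h' -> b \oc f = f' \oc a ->
    exists2 c : mor z z',
      c \oc g = g' \oc b & fmap Sg a \oc h = h' \oc c;
  dtri_octahedral : forall x y z z' x' y' (f : mor x y) (g : mor y z)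
      (f1 : mor y z') (f2 : mor z' (Sg x))
      (g1 : mor z x') (g2 : mor x' (Sg y))
      (h1 : mor z y') (h2 : mor y' (Sg x)),
    dtri f f1 f2 -> dtri g g1 g2 -> dtri (g \oc f) h1 h2 ->
    exists (a : mor z' y') (b : mor y' x'),
      [/\ dtri a b (fmap Sg f1 \oc g2),
          a \oc f1 = h1 \oc g, h2 \oc a = f2,
          b \oc h1 = g1 & g2 \oc b = fmap Sg f \oc h2]
}.

Arguments Sg {k} t.
Arguments SgV {k} t.
Arguments dtri {k} t [x y z] f g h.

Section Tri.
Variables (k : fieldType) (C : triangulated_category k).
Implicit Types (x y z c : C) (T U : set C).

(* Hom(x, y) ~ D Hom(y, Sg^2 x), naturally in [x] and [y]. *)
Definition calabi_yau2 : Prop :=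
  exists phi : forall x y, mor x y -> 'Hom(mor y (Sg C (Sg C x)), k^o),
    [/\ forall x y, linear (@phi x y),
        forall x y, bijective (@phi x y) &
        forall x' x y y' (a : mor x' x) (b : mor y y') (f : mor x y)
            (g : mor y' (Sg C (Sg C x'))),
          phi _ _ (b \oc f \oc a) g =
          phi _ _ f (fmap (Sg C) (fmap (Sg C) a) \oc g \oc b)].

Definition iso_closed T : Prop := forall x y, isomorphic x y -> T x -> T y.

Definition right_approx T t c (f : mor t c) : Prop :=
  T t /\ forall t' (g : mor t' c), T t' -> exists h : mor t' t, g = f \oc h.

Definition left_approx T c t (f : mor c t) : Prop :=
  T t /\ forall t' (g : mor c t'), T t' -> exists h : mor t t', g = h \oc f.

Definition right_minimal x y (f : mor x y) : Prop :=
  forall g : mor x x, f \oc g = f -> is_iso g.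

Definition left_minimal x y (f : mor x y) : Prop :=
  forall g : mor y y, g \oc f = f -> is_iso g.

Definition functorially_finite T : Prop :=
  forall c, (exists t (f : mor t c), right_approx T f) /\
            (exists t (f : mor c t), left_approx T f).

(* Full subcategories are given by their sets of objects. *)
Definition cluster_tilting T : Prop :=
  [/\ iso_closed T, functorially_finite T,
      T = [set c | forall t, T t -> forall f : mor (SgV C t) c, f = 0] &
      T = [set c | forall t, T t -> forall f : mor c (Sg C t), f = 0]].

Definition add_cat T : set C :=
  [set c | exists n (x : 'I_n -> C) d s,
     [/\ forall j, T (x j), is_dsum x s & is_biproduct c d s]].

Definition indec_classes T : set (set C) :=
  [set X | exists2 t, T t & indecomposable t /\ X = [set x | isomorphic x t]].

Definition Indec T : choiceType := {X : set C | X \in indec_classes T}.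

Lemma Indec_exP T (X : Indec T) :
  exists2 t, T t & indecomposable t /\ val X = [set x | isomorphic x t].
Proof. exact: set_mem (valP X). Qed.

Definition irepr T (X : Indec T) : {t : C | T t} :=
  let t := cid2 (Indec_exP X) in exist T (s2val t) (s2valP t).

Lemma indec_classesP T t : T t -> indecomposable t ->
  [set x | isomorphic x t] \in indec_classes T.
Proof. by move=> Tt it; apply/mem_set; exists t. Qed.

Definition indec_cls T t (Tt : T t) (it : indecomposable t) : Indec T :=
  exist (fun X => X \in indec_classes T) _ (indec_classesP Tt it).

Lemma indec_classesT T (X : Indec T) : val X \in indec_classes setT.
Proof. by have [t _ [it ->]] := Indec_exP X; exact: indec_classesP. Qed.

Definition Indec_incl T (X : Indec T) : Indec setT :=
  exist (fun X => X \in indec_classes setT) _ (indec_classesT X).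

Definition K0 T : lmodType int := {freeg (Indec T) / int}.

Definition K0_gen T (X : Indec T) : K0 T := << X >>.

Definition K0_lift T (M : lmodType int) (f : Indec T -> M) : K0 T -> M :=
  fglift f.

HB.instance Definition _ T (M : lmodType int) (f : Indec T -> M) :=
  GRing.isZmodMorphism.Build (K0 T) M (K0_lift f) (lift_is_additive f).

Definition K0_eval T (f : Indec T -> int) : K0 T -> int :=
  K0_lift (f : Indec T -> int^o).

HB.instance Definition _ T (f : Indec T -> int) :=
  GRing.isZmodMorphism.Build (K0 T) int (K0_eval f)
    (@lift_is_additive _ _ int^o f).

Definition K0_incl T : {additive K0 T -> K0 setT} :=
  K0_lift (fun X => K0_gen (Indec_incl X)).

(* The class of an arbitrary object of [T], computed from a decomposition into
   indecomposable objects of [T]; it is independent of the decomposition in a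
   Krull-Schmidt category. *)
Definition K0_cls T c : K0 T :=
  xget 0 [set a | exists n (X : 'I_n -> Indec T),
    is_dsum (fun j => sval (irepr (X j))) c /\ a = \sum_j K0_gen (X j)].

Definition Zdual (A : zmodType) := {additive A -> int}.

HB.instance Definition _ (A : zmodType) := gen_eqMixin (Zdual A).
HB.instance Definition _ (A : zmodType) := gen_choiceMixin (Zdual A).

Definition K0_gen_dual T (X : Indec T) : Zdual (K0 T) :=
  K0_eval (fun Y => (X == Y)%:R).

Definition positive T (a : Zdual (K0 T)) : Prop := forall X, 0 <= a (K0_gen X).

(* The next definitions choose an element with the defining property; for
   cluster tilting subcategories of a 2-Calabi-Yau Krull-Schmidt category it
   exists and is unique, so that the default value [0] is never used. *)
Definition ind T s : K0 T :=
  xget 0 [set a | exists t1 t0 (f : mor t1 t0) (g : mor t0 s)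
      (h : mor s (Sg C t1)),
    [/\ T t1, T t0, dtri C f g h & a = K0_cls T t0 - K0_cls T t1]].

Definition coind U c : K0 U :=
  xget 0 [set a | exists u0 u1 (f : mor c u0) (g : mor u0 u1)
      (h : mor u1 (Sg C c)),
    [/\ U u0, U u1, dtri C f g h & a = K0_cls U u0 - K0_cls U u1]].

Definition coind_hom U : {additive K0 setT -> K0 U} :=
  K0_lift (fun X => coind U (sval (irepr X))).

Definition cvector T U (u : Indec U) : Zdual (K0 T) :=
  xget (\0 : Zdual (K0 T))
    [set a : Zdual (K0 T) |
      forall v : Indec U, a (ind T (sval (irepr v))) = (u == v)%:R].

Definition vspan (V : vectType k) (P : set V) : {vspace V} :=
  xget 0%VS [set W : {vspace V} | (forall v, P v -> v \in W) /\
    forall W' : {vspace V}, (forall v, P v -> v \in W') -> (W <= W')%VS].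

(* As [T] is a full subcategory, its radical is that of [C] restricted to the
   objects of [T]; the square of the radical does depend on [T]. *)
Definition rad x y : set (mor x y) :=
  [set f | forall g : mor y x, is_iso (idm x - g \oc f)].

Definition rad2 T x y : set (mor x y) :=
  [set f | exists z (g : mor x z) (h : mor z y),
    [/\ T z, rad g, rad h & f = h \oc g]].

(* [rad] is a subspace, and the square of the radical, spanned by [rad2], is
   contained in it, so this is the dimension of the quotient space. *)
Definition arrows T (X Y : Indec T) : nat :=
  (\dim (vspan (@rad (sval (irepr X)) (sval (irepr Y)))) -
   \dim (vspan (rad2 T (x := sval (irepr X)) (y := sval (irepr Y)))))%N.

Definition no_loops T : Prop := forall X : Indec T, arrows X X = 0%N.

Definition no_2cycles T : Prop :=
  forall X Y : Indec T, X <> Y -> ~ ((0 < arrows X Y)%N /\ (0 < arrows Y X)%N).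

Definition Indec_minus U u : set C :=
  [set x | [/\ U x, indecomposable x & ~ isomorphic x u]].

Definition is_mutation U u u' : Prop :=
  [/\ indecomposable u', ~ isomorphic u' u &
      cluster_tilting (add_cat (Indec_minus U u `|` [set u']))].

Definition exchange_triangle U u u' e
    (f : mor u' e) (g : mor e u) (d : mor u (Sg C u')) : Prop :=
  [/\ dtri C f g d,
      left_approx (add_cat (Indec_minus U u)) f /\ left_minimal f &
      right_approx (add_cat (Indec_minus U u)) g /\ right_minimal g].

Definition shifts T : set C := [set x | exists2 t, T t & isomorphic x (Sg C t)].

Definition factors_through T x y (f : mor x y) : Prop :=
  exists z (a : mor x z) (b : mor z y), T z /\ f = b \oc a.

(* Linear functors from the opposite of [T] to finite dimensional spaces *)
Record tmodule T := TModule {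
  mobj :> {t : C | T t} -> vectType k;
  mmap : forall s t : {t : C | T t},
    mor (sval s) (sval t) -> 'Hom(mobj t, mobj s);
  mmap_linear : forall s t, linear (@mmap s t);
  mmap_id : forall t, mmap (idm (sval t)) = \1%VF;
  mmap_comp : forall r s t (g : mor (sval s) (sval t))
      (f : mor (sval r) (sval s)), mmap (g \oc f) = (mmap f \o mmap g)%VF
}.

Arguments mmap {T} M [s t] f : rename.

Record tmorphism T (M N : tmodule T) := TMorphism {
  tmap :> forall t, 'Hom(M t, N t);
  tmap_nat : forall s t (f : mor (sval s) (sval t)),
    (tmap s \o mmap M f = mmap N f \o tmap t)%VF
}.

Section Yoneda.
Variables (T : set C).

Let ymap c (s t : {t : C | T t}) (f : mor (sval s) (sval t)) :
    'Hom(mor (sval t) c, mor (sval s) c) := linfun (precomp f).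

Let ymap_linear c s t : linear (@ymap c s t).
Proof.
move=> a f g; apply/lfunP => h; rewrite add_lfunE scale_lfunE !lfunE /=.
exact: (comp_linear_r _ h).
Qed.

Let ymap_id c t : @ymap c t t (idm (sval t)) = \1%VF.
Proof. by apply/lfunP => h; rewrite !lfunE /= /precomp comp_idr. Qed.

Let ymap_comp c r s t (g : mor (sval s) (sval t)) (f : mor (sval r) (sval s)) :
  @ymap c r t (g \oc f) = (@ymap c r s f \o @ymap c s t g)%VF.
Proof. by apply/lfunP => h; rewrite !lfunE /= !lfunE /= /precomp comp_assoc. Qed.

Definition yoneda c : tmodule T :=
  TModule (@ymap_linear c) (@ymap_id c) (@ymap_comp c).

Let ymor_nat c d (f : mor c d) s t (g : mor (sval s) (sval t)) :
  (linfun (mcomp f) \o mmap (yoneda c) g =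
   mmap (yoneda d) g \o linfun (mcomp f))%VF.
Proof. by apply/lfunP => h; rewrite !lfunE /= !lfunE /= /precomp comp_assoc. Qed.

Definition yoneda_map c d (f : mor c d) : tmorphism (yoneda c) (yoneda d) :=
  @TMorphism T (yoneda c) (yoneda d)
    (fun t => linfun (mcomp f : mor (sval t) c -> mor (sval t) d))
    (@ymor_nat c d f).

End Yoneda.

Section Image.
Variables (T : set C) (M N : tmodule T) (al : tmorphism M N).

Let iobj t : vectType k := subvs_of (limg (al t)).

Let imap s t (f : mor (sval s) (sval t)) : 'Hom(iobj t, iobj s) :=
  linfun (vsproj (limg (al s)) \o mmap N f \o vsval).

Let imap_val s t (f : mor (sval s) (sval t)) (v : iobj t) :
  vsval (imap f v) = mmap N f (vsval v).
Proof.
rewrite lfunE /= vsprojK //; have /memv_imgP[w _ ->] := subvsP v.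
have /lfunP/(_ w) := tmap_nat al f; rewrite !lfunE /= => <-.
exact: memv_img (memvf _).
Qed.

Let imap_linear s t : linear (@imap s t).
Proof.
move=> a f g; apply/lfunP => v; apply: subvs_inj.
rewrite add_lfunE scale_lfunE linearP /= !imap_val (mmap_linear N).
by rewrite add_lfunE scale_lfunE.
Qed.

Let imap_id t : @imap t t (idm (sval t)) = \1%VF.
Proof. by apply/lfunP => v; apply: subvs_inj; rewrite imap_val mmap_id !lfunE. Qed.

Let imap_comp r s t (g : mor (sval s) (sval t)) (f : mor (sval r) (sval s)) :
  @imap r t (g \oc f) = (@imap r s f \o @imap s t g)%VF.
Proof.
apply/lfunP => v; apply: subvs_inj.
by rewrite imap_val mmap_comp !comp_lfunE !imap_val.
Qed.

Definition timage : tmodule T :=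
  TModule imap_linear imap_id imap_comp.

End Image.

Definition dimvec T (M : tmodule T) : Zdual (K0 T) :=
  K0_eval (fun X => (\dim {:M (irepr X)})%:R).

End Tri.

(* Main.v *)
(** Multiplicities of indecomposables are dimensions of Hom spaces modulo
    radicals, hence additive on direct sums.  If [a -> b -> v] is a triangle with
    [v] in [U], the octahedral axiom turns a [U]-coresolution [a -> u0 -> u1]
    into [b -> u0 (+) v -> u1], so [coind U b = coind U a + [v]].  Applied to
    [t1 -> t0 -> v], this says that [coind U] is left inverse to [ind T]; that it
    is also right inverse follows from [ind T s = - coind T (Sg^-1 s)].  Hence
    the formula for the c-vector.

    Without loops, Nakayama's lemma gives [Hom(u, Sg u') = k d], so that
    [dim Hom(x, Sg u')] is the multiplicity of [u] in [x] for [x] in [U].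
    Applying [Hom(-, Sg u')] to [t -> u0 -> u1 -> Sg t], the value of the
    c-vector at [t] is the dimension of the image of
    [d_* : Hom(t, u) -> Hom(t, Sg u')] minus the dimension of
    [{Sg b \oc ga | b : t -> u'}] with [ga : u1 -> Sg t].  If [d_*] is nonzero
    on [T], then by Serre duality every map from [Sg u'] to [Sg^2 x], [x] in
    [U], factors through some [Sg^2 t'] with [t'] in [T]; by duality again and
    rigidity of [T], the second term vanishes.  If [d_* = 0] on [T], then the
    c-vector is [<= 0]; being nonzero, it is not positive. *)

Require Import Defs.
From HB Require Import structures.
From mathcomp Require Import all_boot all_order all_algebra.
From mathcomp Require Import boolp classical_sets.
From mathcomp Require Import freeg.

Set Implicit Arguments.
Unset Strict Implicit.
Unset Printing Implicit Defensive.

Import Order.TTheory GRing.Theory Num.Theory passmx.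
Local Open Scope classical_set_scope.
Local Open Scope ring_scope.

(** * Subspaces and eigenvectors *)

Section VectorSpaces.
Variables (k : fieldType).
Implicit Types (V : vectType k).

(** Among the subspaces contained in [P], one of maximal dimension exhausts [P]: joining the line of
    a further [v] in [P] stays inside [P]. *)
Lemma ex_vspace_of V (P : set V) : P 0 ->
  (forall a v w, P v -> P w -> P (a *: v + w)) ->
  exists W : {vspace V}, forall v, v \in W <-> P v.
Proof.
move=> P0 Plin.
pose Q n := `[< exists W : {vspace V}, (forall v, v \in W -> P v) /\ \dim W = n >].
have Q0 : exists n, Q n.
  exists 0%N; apply/asboolP; exists 0%VS; split; last exact: dimv0.
  by move=> v; rewrite memv0 => /eqP->.
have Qmax n : Q n -> (n <= dim V)%N.
  by move=> /asboolP[W [_ <-]]; rewrite -dimvf; exact/dimvS/subvf.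
case: (ex_maxnP Q0 Qmax) => n /asboolP[W [WP dW]] nmax.
exists W => v; split; [exact: WP | move=> Pv].
have /nmax : Q (\dim (<[v]> + W)%VS).
  apply/asboolP; exists (<[v]> + W)%VS; split=> // x.
  move=> /memv_addP[x1 /vlineP[a ->] [w wW ->]].
  by apply: Plin => //; exact: WP.
rewrite -dW => dle; have := eqEdim W (<[v]> + W)%VS.
by rewrite addvSr dle /= => /eqP ->; exact: (subvP (addvSl _ _)) (memv_line v).
Qed.

(** The vectors lying in every subspace that contains [P] form the least such subspace, so [vspan]
    never takes its default value. *)
Lemma vspanP V (P : set V) : (forall v, P v -> v \in vspan P) /\
  forall W' : {vspace V}, (forall v, P v -> v \in W') -> (vspan P <= W')%VS.
Proof.
pose S : set V := [set v | forall W : {vspace V},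
  (forall w, P w -> w \in W) -> v \in W].
have [||W WS] := @ex_vspace_of V S.
- by move=> W _; exact: mem0v.
- by move=> a v w Sv Sw W PW; rewrite rpredD ?rpredZ ?Sv ?Sw.
apply: (xgetPex 0%VS (P := [set W : {vspace V} | (forall v, P v -> v \in W) /\
    forall W' : {vspace V}, (forall v, P v -> v \in W') -> (W <= W')%VS])).
exists W; split=> [v Pv | W' PW']; first by apply/WS => W'; apply.
by apply/subvP => v /WS; apply.
Qed.

Lemma mem_vspan V (P : set V) : P 0 ->
  (forall a v w, P v -> P w -> P (a *: v + w)) ->
  forall v, v \in vspan P <-> P v.
Proof.
move=> P0 Plin v; have [W WP] := ex_vspace_of P0 Plin.
have [sub min] := vspanP P; split; last exact: sub.
by move=> vP; apply/WP; apply: subvP vP; apply: min => w /WP.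
Qed.

(** Stated for subspaces respected by the inclusions and projections, so that it serves Hom spaces
    in either variable as well as their radicals. *)
Lemma dim_dsum V n (Vs : 'I_n -> vectType k) (W : {vspace V})
    (Ws : forall j, {vspace Vs j})
    (i : forall j, 'Hom(Vs j, V)) (p : forall j, 'Hom(V, Vs j)) :
  (forall j v, p j (i j v) = v) ->
  (forall j l v, j != l -> p j (i l v) = 0) ->
  (forall v, \sum_j i j (p j v) = v) ->
  (forall j v, v \in Ws j -> i j v \in W) ->
  (forall j v, v \in W -> p j v \in Ws j) ->
  \dim W = (\sum_j \dim (Ws j))%N.
Proof.
move=> pi_id pi0 ip iW pW.
have dimi j : \dim (i j @: Ws j)%VS = \dim (Ws j).
  apply: limg_dim_eq; apply/eqP; rewrite -subv0; apply/subvP => v.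
  rewrite memv_cap memv_ker memv0 => /andP[_ /eqP ijv0].
  by rewrite -(pi_id j v) ijv0 linear0.
have -> : W = (\sum_j i j @: Ws j)%VS.
  apply/vspaceP => v; apply/idP/idP => [vW | /memv_sumP[vs vsW ->]].
    rewrite -(ip v); apply: rpred_sum => j _.
    by apply: (subvP (sumv_sup j _ (subvv _))) => //; apply: memv_img; exact: pW.
  by apply: rpred_sum => j _; have /memv_imgP[w wW ->] := vsW j isT; exact: iW.
rewrite -(eq_bigr _ (fun j _ => dimi j)).
suff /directvP-> : directv (\sum_j i j @: Ws j)%VS by [].
apply/directv_sum_independent => vs vsW vs0 j _.
have /memv_imgP[w _ vsj] := vsW j isT; rewrite vsj.
suff -> : w = 0 by rewrite linear0.
rewrite -(pi_id j w) -vsj -[RHS](linear0 (p j)) -vs0 linear_sum (bigD1 j) //=.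
rewrite big1 ?addr0 // => l lj; have /memv_imgP[w' _ ->] := vsW l isT.
by rewrite pi0 // eq_sym.
Qed.

End VectorSpaces.

Lemma eigenvector (K : closedFieldType) (V : vectType K) (f : 'End(V)) :
  (0 < dim V)%N -> exists a v, v != 0 /\ f v = a *: v.
Proof.
move=> V0; pose e := vbasis (fullv : {vspace V}).
have eb : basis_of {:V} e := vbasisP fullv.
pose A := mxof e e f.
have : size (char_poly A) != 1%N by rewrite size_char_poly dimvf; case: (dim V) V0.
case/closed_rootP => a; rewrite -eigenvalue_root_char => /eigenvalueP[v vA v0].
exists a, (vecof e v); rewrite vecof_eq0 //; split => //.
by rewrite (hom_vecof e eb) vA linearZ.
Qed.

(** * Local objects and multiplicities *)

Section LinearCategory.
Variables (k : fieldType) (C : linear_category k).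
Implicit Types (x y z w c d : C).

Lemma compDl x y z (g g' : mor y z) (f : mor x y) :
  (g + g') \oc f = g \oc f + g' \oc f.
Proof. exact: (linearD (precomp f)). Qed.

Lemma compDr x y z (g : mor y z) (f f' : mor x y) :
  g \oc (f + f') = g \oc f + g \oc f'.
Proof. exact: linearD. Qed.

Lemma compNl x y z (g : mor y z) (f : mor x y) : (- g) \oc f = - (g \oc f).
Proof. exact: (linearN (precomp f)). Qed.

Lemma compNr x y z (g : mor y z) (f : mor x y) : g \oc (- f) = - (g \oc f).
Proof. exact: linearN. Qed.

Lemma compBl x y z (g g' : mor y z) (f : mor x y) :
  (g - g') \oc f = g \oc f - g' \oc f.
Proof. exact: (linearB (precomp f)). Qed.

Lemma compBr x y z (g : mor y z) (f f' : mor x y) :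
  g \oc (f - f') = g \oc f - g \oc f'.
Proof. exact: linearB. Qed.

Lemma compZl x y z a (g : mor y z) (f : mor x y) : (a *: g) \oc f = a *: (g \oc f).
Proof. exact: (linearZ_LR (precomp f)). Qed.

Lemma compZr x y z a (g : mor y z) (f : mor x y) : g \oc (a *: f) = a *: (g \oc f).
Proof. exact: linearZ_LR. Qed.

Lemma comp0l x y z (f : mor x y) : (0 : mor y z) \oc f = 0.
Proof. exact: (linear0 (precomp f)). Qed.

Lemma comp0r x y z (g : mor y z) : g \oc (0 : mor x y) = 0.
Proof. exact: linear0. Qed.

Lemma comp_suml x y z n (g : 'I_n -> mor y z) (f : mor x y) :
  (\sum_j g j) \oc f = \sum_j g j \oc f.
Proof. exact: (linear_sum (precomp f)). Qed.

Lemma comp_sumr x y z n (g : mor y z) (f : 'I_n -> mor x y) :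
  g \oc (\sum_j f j) = \sum_j g \oc f j.
Proof. exact: linear_sum. Qed.

Lemma is_iso_id x : is_iso (idm x).
Proof. by exists (idm x); rewrite comp_idl. Qed.

Lemma is_iso_comp x y z (g : mor y z) (f : mor x y) :
  is_iso g -> is_iso f -> is_iso (g \oc f).
Proof.
move=> [g' g'g gg'] [f' f'f ff']; exists (f' \oc g').
  by rewrite comp_assoc -(comp_assoc f') g'g comp_idr.
by rewrite comp_assoc -(comp_assoc g) ff' comp_idr.
Qed.

Lemma isomorphic_refl x : isomorphic x x.
Proof. by exists (idm x); exact: is_iso_id. Qed.

Lemma isomorphic_sym x y : isomorphic x y -> isomorphic y x.
Proof. by case=> f [g gf fg]; exists g, f. Qed.

Lemma isomorphic_trans y x z : isomorphic x y -> isomorphic y z -> isomorphic x z.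
Proof. by case=> f fi [g gi]; exists (g \oc f); exact: is_iso_comp. Qed.

Lemma iso_classE x y :
  [set z | isomorphic z x] = [set z | isomorphic z y] <-> isomorphic x y.
Proof.
split=> [/seteqP[+ _] | xy]; first by apply; exact: isomorphic_refl.
apply/seteqP; split=> z /= zx; first exact: isomorphic_trans xy.
by apply: isomorphic_trans zx _; exact: isomorphic_sym.
Qed.

Lemma mor_to_zero x y (f : mor x y) : is_zero y -> f = 0.
Proof. by move=> y0; rewrite -(comp_idl f) y0 comp0l. Qed.

Lemma zero_biproduct x z : is_zero z -> is_biproduct x z x.
Proof.
move=> z0; exists (idm x), 0, (idm x), 0.
by rewrite !comp_idl !comp0r !comp0l addr0.
Qed.

Lemma biproduct_zero_iso x z c : is_zero z -> is_biproduct x z c -> isomorphic x c.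
Proof.
move=> z0 [i [j [p [q [pi qj pj qi ijpq]]]]]; exists i, p => //.
by rewrite -ijpq (mor_to_zero q z0) comp0r addr0.
Qed.

Lemma biproduct_dsum x y c : is_biproduct x y c ->
  is_dsum (fun j : 'I_2 => if (j : nat) is 0 then x else y) c.
Proof.
move=> [i [j [p [q [pi qj pj qi ijpq]]]]].
pose X (n : nat) := if n is 0 then x else y.
pose I n : mor (X n) c := if n is 0 then i else j.
pose P n : mor c (X n) := if n is 0 then p else q.
exists (fun m => I m), (fun m => P m); split.
- by case=> -[|[]].
- by case=> -[|[|//]] ? [[|[|//]] ?].
- by rewrite big_ord_recl big_ord1.
Qed.

Lemma dsum1 x : is_dsum (fun _ : 'I_1 => x) x.
Proof.
exists (fun _ => idm x), (fun _ => idm x); split.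
- by move=> _; rewrite comp_idl.
- by move=> j l; rewrite !ord1.
- by rewrite big_ord1 comp_idl.
Qed.

Lemma isomorphicT x y : isomorphic x y ->
  {f : mor x y & {g : mor y x | g \oc f = idm x /\ f \oc g = idm y}}.
Proof. by move=> /cid[f /cid2[g gf fg]]; exists f, g. Qed.

Lemma dsum_iso n (X Y : 'I_n -> C) c d : (forall j, isomorphic (X j) (Y j)) ->
  isomorphic c d -> is_dsum X c -> is_dsum Y d.
Proof.
move=> XY [f [f' f'f ff']] [i [p [pi pi0 ip]]].
have r j := isomorphicT (XY j).
pose a j := tag (r j); pose b j := sval (tagged (r j)).
have ba j : b j \oc a j = idm (X j) := (svalP (tagged (r j))).1.
have ab j : a j \oc b j = idm (Y j) := (svalP (tagged (r j))).2.
exists (fun j => f \oc i j \oc b j), (fun j => a j \oc p j \oc f'); split.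
- move=> j; rewrite !comp_assoc -(comp_assoc (a j \oc p j)) f'f comp_idr.
  by rewrite -(comp_assoc (a j)) pi comp_idr.
- move=> j l jl; rewrite !comp_assoc -(comp_assoc (a j \oc p j)) f'f comp_idr.
  by rewrite -(comp_assoc (a j)) pi0 // comp0r comp0l.
- rewrite -ff' -[f in RHS]comp_idr -ip comp_sumr comp_suml; apply: eq_bigr => j _.
  by rewrite !comp_assoc -(comp_assoc (f \oc i j)) ba comp_idr.
Qed.

Lemma dsum_lift0 n (X : 'I_n.+1 -> C) c c' :
  is_dsum X c -> is_dsum (X \o fintype.lift ord0) c' -> is_biproduct (X ord0) c' c.
Proof.
move=> [i [p [pi pi0 ip]]] [i' [p' [pi' pi0' ip']]].
exists (i ord0), (\sum_j i (fintype.lift ord0 j) \oc p' j), (p ord0).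
exists (\sum_j i' j \oc p (fintype.lift ord0 j)).
have lift0 j : fintype.lift ord0 j != ord0 :> 'I_n.+1 by rewrite eq_sym neq_lift.
split; first exact: pi.
- rewrite comp_suml -ip'; apply: eq_bigr => j _.
  rewrite comp_sumr (bigD1 j) //= comp_assoc -(comp_assoc (i' j)) pi comp_idr.
  rewrite big1 ?addr0 // => l lj; rewrite comp_assoc -(comp_assoc (i' j)).
  by rewrite pi0 ?comp0r ?comp0l // (inj_eq lift_inj) eq_sym.
- by rewrite comp_sumr big1 // => j _; rewrite comp_assoc pi0 ?comp0l // neq_lift.
- by rewrite comp_suml big1 // => j _; rewrite -comp_assoc pi0 ?comp0r.
rewrite -ip big_ord_recl; congr (_ + _).
rewrite comp_suml; apply: eq_bigr => j _; rewrite comp_sumr (bigD1 j) //=.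
rewrite comp_assoc -(comp_assoc (i _)) pi' comp_idr big1 ?addr0 // => l lj.
by rewrite comp_assoc -(comp_assoc (i _)) pi0' ?comp0r ?comp0l // eq_sym.
Qed.

Lemma is_iso_cancel x y z (g : mor y z) (f : mor x y) :
  is_iso g -> is_iso (g \oc f) -> is_iso f.
Proof.
move=> gi gfi; have [g' g'g gg'] := gi.
rewrite -(comp_idl f) -g'g -comp_assoc; apply: is_iso_comp => //.
by exists g.
Qed.

Lemma is_iso_cancel_r x y z (g : mor y z) (f : mor x y) :
  is_iso f -> is_iso (g \oc f) -> is_iso g.
Proof.
move=> fi gfi; have [f' f'f ff'] := fi.
rewrite -(comp_idr g) -ff' comp_assoc; apply: is_iso_comp => //.
by exists f.
Qed.

Lemma is_isoZ x y a (f : mor x y) : a != 0 -> is_iso (a *: f) -> is_iso f.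
Proof.
move=> a0 [g gf fg]; exists (a *: g).
  by rewrite compZl -compZr.
by rewrite compZr -compZl.
Qed.

Lemma not_iso0 x : ~ is_zero x -> ~ is_iso (0 : mor x x).
Proof. by move=> x0 [g]; rewrite comp0r => /esym. Qed.

Lemma local_end_iso x y : isomorphic x y -> local_end x -> local_end y.
Proof.
move=> [f [g gf fg]] [x0 xl]; have fi : is_iso f by exists g.
have gi : is_iso g by exists f.
split=> [y0|h]; first by apply: x0; rewrite /is_zero -gf -(comp_idl f) y0 comp0l comp0r.
have conj (h' : mor y y) : is_iso (g \oc h' \oc f) -> is_iso h'.
  move=> hi; have -> : h' = f \oc (g \oc h' \oc f) \oc g.
    by rewrite !comp_assoc fg comp_idl -comp_assoc fg comp_idr.
  by do 2!apply: is_iso_comp => //.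
case: (xl (g \oc h \oc f)) => hi; [left|right]; apply: conj => //.
by rewrite compBr compBl comp_idr gf.
Qed.

(** One of the complementary idempotents [i \oc p] and [j \oc q] is invertible, which forces the
    summand it kills to be zero. *)
Lemma local_end_indec x : local_end x -> indecomposable x.
Proof.
move=> [x0 xl]; split=> // y z [i [j [p [q [pi qj pj qi ijpq]]]]].
case: (xl (i \oc p));
  [move=> [h hip _]; right | rewrite -ijpq [i \oc p + _]addrC addrK].
  rewrite /is_zero -qj -(comp_idl j) -hip -!comp_assoc pj.
  by rewrite !comp0r.
move=> [h hjq _]; left; rewrite /is_zero -pi -(comp_idl i) -hjq -!comp_assoc qi.
by rewrite !comp0r.
Qed.

(** With [h] inverse to [g \oc f], the map [f \oc h \oc g] is an idempotent of [y]. By locality it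
    or its complement is invertible: an invertible idempotent is the identity, and an invertible
    complement would force [f = 0]. *)
Lemma local_retract x y (f : mor x y) (g : mor y x) :
  ~ is_zero x -> local_end y -> is_iso (g \oc f) -> is_iso f.
Proof.
move=> x0 [_ yl] [h hgf gfh].
case: (yl (f \oc h \oc g)) => [[e' e'e ee']|[e' e'e ee']].
  exists (h \oc g); rewrite -?comp_assoc // comp_assoc.
  have ee : f \oc h \oc g \oc (f \oc h \oc g) = f \oc h \oc g.
    by rewrite !comp_assoc -(comp_assoc (f \oc h)) -(comp_assoc f) hgf comp_idr.
  by rewrite -[LHS]comp_idr -ee' comp_assoc ee.
case: x0; have ef0 : f \oc h \oc g \oc f = f by rewrite -2!comp_assoc hgf comp_idr.
have f0 : f = 0.
  by rewrite -(comp_idl f) -e'e -comp_assoc compBl comp_idl ef0 subrr comp0r.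
by rewrite /is_zero -hgf f0 !comp0r.
Qed.

Lemma local_notisoD x (f g : mor x x) : local_end x ->
  ~ is_iso f -> ~ is_iso g -> ~ is_iso (f + g).
Proof.
move=> [_ xl] fn gn fgi; have [h hfg fgh] := fgi.
have hi : is_iso h by exists (f + g).
case: (xl (h \oc f)) => [/(is_iso_cancel hi)|]//.
by rewrite -hfg compDr addrC addKr => /(is_iso_cancel hi).
Qed.

End LinearCategory.

(** * Residue fields and multiplicities of local objects *)

Section Multiplicity.
Variables (k : closedFieldType) (C : linear_category k).
Implicit Types (x y z w c d : C).

(** Precomposition with [f] on the finite dimensional space [mor x x] has an eigenvalue [a], and
    [f - a *: idm x] then annihilates a nonzero map. Hence the residue field of the endomorphism
    ring is [k]. *)
Lemma local_residue x (f : mor x x) : local_end x ->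
  exists a, ~ is_iso (f - a *: idm x).
Proof.
move=> [x0 _]; have dx : (0 < dim (mor x x))%N.
  rewrite -dimvf lt0n dimv_eq0; apply/eqP => xx0; apply: x0.
  by apply/eqP; rewrite -memv0 -xx0 memvf.
have [a [v [v0]]] := eigenvector (linfun (precomp f)) dx.
rewrite lfunE /= /precomp => vf; exists a => -[g _ fg]; case/negP: v0; apply/eqP.
by rewrite -(comp_idr v) -fg comp_assoc compBr vf compZr comp_idr subrr comp0l.
Qed.

(** For local [w] these are exactly the radical maps, and the span adds nothing. *)
Definition Rad w c : {vspace mor w c} :=
  vspan [set f | forall g : mor c w, ~ is_iso (g \oc f)].

Lemma mem_Rad w c (f : mor w c) : local_end w ->
  f \in Rad w c <-> forall g : mor c w, ~ is_iso (g \oc f).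
Proof.
move=> wl; have w0 := not_iso0 wl.1; apply: mem_vspan => [g|a v v' vn v'n g].
  by rewrite comp0r.
rewrite compDr compZr; apply: local_notisoD => //.
have [->|a0] := eqVneq a 0; first by rewrite scale0r.
by move/(is_isoZ a0); exact: vn.
Qed.

Definition mult w c : nat := (dim (mor w c) - \dim (Rad w c))%N.

Lemma mult_dsum w n (X : 'I_n -> C) c : local_end w -> is_dsum X c ->
  mult w c = (\sum_j mult w (X j))%N.
Proof.
move=> wl [i [p [pi pi0 ip]]]; rewrite /mult sumnB => [|j _]; last first.
  by rewrite -dimvf dimvS // subvf.
have dd (W : {vspace mor w c}) (Ws : forall j, {vspace mor w (X j)}) :
    (forall j v, v \in Ws j -> i j \oc v \in W) ->
    (forall j v, v \in W -> p j \oc v \in Ws j) -> \dim W = (\sum_j \dim (Ws j))%N.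
  move=> iW pW; apply: (@dim_dsum _ _ _ _ W Ws
    (fun j => linfun (mcomp (i j))) (fun j => linfun (mcomp (p j)))).
  - by move=> j v; rewrite !lfunE /= comp_assoc pi comp_idl.
  - by move=> j l v jl; rewrite !lfunE /= comp_assoc pi0 // comp0l.
  - move=> v; rewrite -[RHS]comp_idl -ip comp_suml; apply: eq_bigr => j _.
    by rewrite !lfunE /= comp_assoc.
  - by move=> j v; rewrite lfunE; exact: iW.
  - by move=> j v; rewrite lfunE; exact: pW.
congr (_ - _)%N.
  rewrite -dimvf (dd fullv (fun j => fullv)); last 2 first.
  - by move=> *; rewrite memvf.
  - by move=> *; rewrite memvf.
  by apply: eq_bigr => j _; rewrite dimvf.
apply: dd => j v /(mem_Rad _ wl) vn; apply/(mem_Rad _ wl) => g.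
  by rewrite comp_assoc.
by rewrite comp_assoc.
Qed.

(** As the residue field of [w] is [k], an isomorphism [th] spans the Hom space modulo the radical
    and is not itself radical. If there is no isomorphism, every map is radical by
    [local_retract]. *)
Lemma mult_local w x : local_end w -> local_end x ->
  mult w x = `[< isomorphic w x >] :> nat.
Proof.
move=> wl xl; have [[th thi]|wx] := asboolP; last first.
  rewrite /mult; suff -> : Rad w x = fullv by rewrite dimvf subnn.
  apply/eqP; rewrite eqEsubv subvf /=; apply/subvP => f _; apply/(mem_Rad _ wl) => g gf.
  by apply: wx; exists f; apply: local_retract gf => //; exact: wl.1.
have [h hth thh] := thi.
rewrite /mult -dimvf; have -> : fullv = (<[th]> + Rad w x)%VS.
  apply/eqP; rewrite eqEsubv subvf andbT; apply/subvP => f _.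
  have [a fa] := local_residue (h \oc f) wl.
  rewrite -(subrK (a *: th) f) addrC.
  apply: memv_add; first by rewrite rpredZ ?memv_line.
  apply/(mem_Rad _ wl) => g gf; apply: fa.
  have -> : h \oc f - a *: idm w = h \oc (f - a *: th) by rewrite compBr compZr hth.
  apply: is_iso_comp; first by exists th.
  by apply: local_retract gf => //; exact: wl.1.
rewrite dimv_disjoint_sum; last first.
  apply/eqP; rewrite -subv0; apply/subvP => f; rewrite memv_cap => /andP[/vlineP[a ->]].
  have [->|a0] := eqVneq a 0; first by rewrite scale0r => _; exact: mem0v.
  move=> /(mem_Rad _ wl)/(_ (a^-1 *: h)); case; rewrite compZl compZr hth scalerA.
  by rewrite mulVf // scale1r; exact: is_iso_id.
rewrite addnK dim_vline; case: eqP => // th0; case: wl.1.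
by rewrite /is_zero -hth th0 comp0r.
Qed.

End Multiplicity.

(** * Triangles *)

Section Functors.
Variables (k : fieldType) (C : linear_category k) (F : endofunctor C).
Implicit Types (x y : C).

HB.instance Definition _ x y :=
  GRing.isLinear.Build k (mor x y) (mor (F x) (F y)) *:%R (fmap F (x := x) (y := y))
    (@fmap_linear _ _ F x y).

Lemma fmap_zero x : is_zero x -> is_zero (F x).
Proof. by move=> x0; rewrite /is_zero -fmap_id x0 linear0. Qed.

End Functors.

Section Triangulated.
Variables (k : fieldType) (C : triangulated_category k).
Implicit Types (x y z w : C).
Local Notation S := (Sg C).
Local Notation S' := (SgV C).

Lemma ex_zero : exists z : C, is_zero z.
Proof.
have x (j : 'I_0) : C by case: j.
have [z [i [p [_ _]]]] := tri_additive x.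
by rewrite big_ord0; exists z.
Qed.

Lemma Sg_inj x y : injective (@fmap _ _ S x y).
Proof.
have [e [ei en]] := SgK C => f g fg.
have [e' e'e ee'] := ei x.
by rewrite -(comp_idr f) -(comp_idr g) -ee' !comp_assoc !en fg.
Qed.

Lemma SgV_inj x y : injective (@fmap _ _ S' x y).
Proof.
have [e [ei en]] := SgVK C => f g fg.
have [e' e'e ee'] := ei x.
by rewrite -(comp_idr f) -(comp_idr g) -ee' !comp_assoc !en fg.
Qed.

(** Conjugating [fmap S' g] by the natural isomorphism gives the candidate; since [S'] is faithful,
    its suspension is [g]. *)
Lemma Sg_full x y (g : mor (S x) (S y)) : exists f, g = fmap S f.
Proof.
have [e [ei en]] := SgK C.
have [e' e'e ee'] := ei x; have [e2 e2e ee2] := ei y.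
exists (e y \oc fmap S' g \oc e'); apply: SgV_inj.
have := en _ _ (e y \oc fmap S' g \oc e').
rewrite -!comp_assoc e'e comp_idr => /(congr1 (mcomp e2)).
by rewrite !comp_assoc e2e !comp_idl.
Qed.

Lemma dtri_comp0 x y z (f : mor x y) (g : mor y z) (h : mor z (S x)) :
  dtri C f g h -> g \oc f = 0.
Proof.
have [o o0] := ex_zero.
move=> fgh; have [c <- _] := dtri_fill (a := idm x) (b := f) (dtri_id x o0) fgh erefl.
by rewrite comp0r.
Qed.

Lemma dtri_lift x y z (f : mor x y) (g : mor y z) (h : mor z (S x)) w
    (a : mor w y) :
  dtri C f g h -> g \oc a = 0 -> exists b, a = f \oc b.
Proof.
have [o o0] := ex_zero.
(* A filler from the rotated identity triangle [w -> o -> S w] is the suspension of the desired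
   lift. *)
move=> /dtri_rot fgh ga; have /dtri_rot wtri := dtri_id w o0.
have [|c _] := dtri_fill (a := a) (b := 0) wtri fgh; first by rewrite comp0r.
have [b ->] := Sg_full c.
rewrite fmap_id compNl compNr comp_idr -fmap_comp => /oppr_inj/Sg_inj ->.
by exists b.
Qed.

Lemma dtri_extend x y z (f : mor x y) (g : mor y z) (h : mor z (S x)) w
    (a : mor y w) :
  dtri C f g h -> a \oc f = 0 -> exists b, a = b \oc g.
Proof.
have [o o0] := ex_zero.
have wtri : dtri C (0 : mor o w) (idm w) (0 : mor w (S o)).
  by apply/dtri_rot; rewrite linear0 oppr0; apply: dtri_id; exact: fmap_zero.
move=> fgh af; have [|c + _] := dtri_fill (a := 0) (b := a) fgh wtri.
  by rewrite comp0r.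
by rewrite comp_idl => <-; exists c.
Qed.

(** Backward rotation. As [S'] is only a quasi-inverse of [S], the last map ends in [S (S' z)] and
    agrees with [g] up to the isomorphism [e]. *)
Lemma dtri_unrot x y z (f : mor x y) (g : mor y z) (h : mor z (S x)) :
  dtri C f g h -> exists (f' : mor (S' z) x) g' (e : mor (S (S' z)) z),
    [/\ is_iso e, g = e \oc g' & dtri C f' f g'].
Proof.
have [e [ei _]] := SgVK C; have [e' e'e ee'] := ei z.
have [f' hE] := Sg_full (- (h \oc e z)).
move=> fgh; exists f', (e' \oc g), (e z); split=> //.
  by rewrite comp_assoc ee' comp_idl.
apply/dtri_rot; rewrite -hE opprK.
apply: (dtri_iso (a := idm x) (b := idm y) (c := e')) fgh; try exact: is_iso_id.
- by exists (e z).
- by rewrite comp_idl comp_idr.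
- by rewrite comp_idr.
- by rewrite fmap_id comp_idl -comp_assoc ee' comp_idr.
Qed.

(** The zero connecting map makes [f] a monomorphism and lets [idm z] lift to a section [s] of [g];
    the retraction [r] comes from lifting [idm y - s \oc g] along [f]. *)
Lemma dtri_split x y z (f : mor x y) (g : mor y z) :
  dtri C f g 0 -> is_biproduct x z y.
Proof.
move=> fg; have fg1 := (dtri_rot _ _ _).1 fg; have fg2 := (dtri_rot _ _ _).1 fg1.
have fmono w (a : mor w x) : f \oc a = 0 -> a = 0.
  move=> fa; have [|b] := @dtri_lift _ _ _ _ _ _ _ (fmap S a) fg2.
    by rewrite compNl -fmap_comp fa linear0 oppr0.
  by rewrite comp0l -(linear0 (@fmap _ _ S _ _)) => /Sg_inj.
have [|s gs] := dtri_lift (a := idm z) fg1; first by rewrite comp0l.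
have gf := dtri_comp0 fg.
have [|r fr] := dtri_lift (a := idm y - s \oc g) fg.
  by rewrite compBr comp_idr comp_assoc -gs comp_idl subrr.
have rf : r \oc f = idm x.
  apply/eqP; rewrite -subr_eq0; apply/eqP/fmono.
  rewrite compBr comp_idr comp_assoc -fr compBl comp_idl -comp_assoc gf comp0r.
  by rewrite subr0 subrr.
exists f, s, r, g; split=> //; last by rewrite -fr subrK.
by apply: fmono; rewrite comp_assoc -fr compBl comp_idl -comp_assoc -gs comp_idr subrr.
Qed.

Lemma yoneda_iso x y (f : mor x y) :
  (forall w (a : mor w x), f \oc a = 0 -> a = 0) ->
  (forall w (b : mor w y), exists a, b = f \oc a) -> is_iso f.
Proof.
move=> inj /(_ _ (idm y))[g fg]; exists g => //.
apply/eqP; rewrite -subr_eq0; apply/eqP/inj.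
by rewrite compBr comp_assoc -fg comp_idl comp_idr subrr.
Qed.

(** The fillers of the summands assemble to a map [c] from [Z] to a cone of [F]. The four-lemma
    arguments, carried out on maps from a test object, show that [c] is an isomorphism. *)
Lemma dtri_dsum n (x y z : 'I_n -> C) (f : forall j, mor (x j) (y j))
    (g : forall j, mor (y j) (z j)) (h : forall j, mor (z j) (S (x j))) X Y Z :
  (forall j, dtri C (f j) (g j) (h j)) ->
  is_dsum x X -> is_dsum y Y -> is_dsum z Z ->
  exists (F : mor X Y) (G : mor Y Z) (H : mor Z (S X)), dtri C F G H.
Proof.
move=> fgh [ix [px [pix pix0 ipx]]] [iy [py [piy piy0 ipy]]] [iz [pz [piz piz0 ipz]]].
have sumE c (A : 'I_n -> C) (a : forall j, mor (A j) c) W (i : forall j, mor (A j) W)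
    (p : forall j, mor W (A j)) (b : forall j, mor c (A j)) l :
    (forall j, p j \oc i j = idm (A j)) ->
    (forall j l, j != l -> p j \oc i l = 0) ->
    (\sum_j a j \oc p j) \oc i l = a l /\ p l \oc (\sum_j i j \oc b j) = b l.
  move=> pi pi0; rewrite comp_suml comp_sumr; split; rewrite (bigD1 l) //=.
    rewrite -comp_assoc pi comp_idr big1 ?addr0 // => j jl.
    by rewrite -comp_assoc pi0 ?comp0r.
  rewrite comp_assoc pi comp_idl big1 ?addr0 // => j jl.
  by rewrite comp_assoc pi0 ?comp0l // eq_sym.
pose F := \sum_j iy j \oc f j \oc px j.
pose G := \sum_j iz j \oc g j \oc py j.
pose H := \sum_j fmap S (ix j) \oc h j \oc pz j.
have [Z' [G' [H' FGH']]] := dtri_cone F.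
have Fi j : iy j \oc f j = F \oc ix j.
  by have [->] := sumE _ _ (fun j => iy j \oc f j) _ _ _ (fun=> 0) j pix pix0.
have c_ j : {c : mor (z j) Z' | c \oc g j = G' \oc iy j &
    fmap S (ix j) \oc h j = H' \oc c}.
  exact/cid2/(dtri_fill (fgh j) FGH' (Fi j)).
pose c : mor Z Z' := \sum_j s2val (c_ j) \oc pz j.
have cG : c \oc G = G'.
  rewrite -[RHS]comp_idr -ipy /c /G !comp_sumr; apply: eq_bigr => j _.
  rewrite comp_suml comp_assoc -(s2valP (c_ j)) (bigD1 j) //=.
  rewrite !comp_assoc -(comp_assoc _ (pz j)) piz comp_idr big1 ?addr0 // => l lj.
  by rewrite !comp_assoc -(comp_assoc _ (pz l)) piz0 // comp0r !comp0l.
have Hc : H' \oc c = H.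
  rewrite /c /H comp_sumr; apply: eq_bigr => j _.
  by rewrite comp_assoc -(s2valP' (c_ j)).
have SpH j : fmap S (px j) \oc H = h j \oc pz j.
  rewrite /H comp_sumr (bigD1 j) //= !comp_assoc -fmap_comp pix fmap_id comp_idl.
  rewrite big1 ?addr0 // => l lj.
  by rewrite !comp_assoc -fmap_comp pix0 1?eq_sym // linear0 !comp0l.
have SipS w (a : mor w (S X)) : a = \sum_j fmap S (ix j) \oc (fmap S (px j) \oc a).
  rewrite -[LHS]comp_idl -fmap_id -ipx linear_sum comp_suml.
  by apply: eq_bigr => j _; rewrite comp_assoc -fmap_comp.
have FGH1 := (dtri_rot _ _ _).1 FGH'; have FGH2 := (dtri_rot _ _ _).1 FGH1.
have fgh1 j := (dtri_rot _ _ _).1 (fgh j); have fgh2 j := (dtri_rot _ _ _).1 (fgh1 j).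
have GF : G \oc F = 0.
  rewrite /F comp_sumr big1 // => j _; rewrite !comp_assoc.
  have [-> _] := sumE _ _ (fun j => iz j \oc g j) _ _ _ (fun=> 0) j piy piy0.
  by rewrite -(comp_assoc _ (g j)) (dtri_comp0 (fgh j)) comp0r comp0l.
(* From [H \oc a = 0] each component of [a] lifts, so [a = G \oc b]; then [G' \oc b = 0], so [b]
   factors through [F], and [G \oc F = 0]. *)
have cinj w (a : mor w Z) : c \oc a = 0 -> a = 0.
  move=> ca; have Ha : H \oc a = 0 by rewrite -Hc -comp_assoc ca comp0r.
  have b_ j : {b : mor w (y j) | pz j \oc a = g j \oc b}.
    apply/cid/(dtri_lift (fgh1 j)).
    by rewrite comp_assoc -SpH -comp_assoc Ha comp0r.
  pose b := \sum_j iy j \oc sval (b_ j).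
  have aE : a = G \oc b.
    rewrite -[LHS]comp_idl -ipz !comp_suml; apply: eq_bigr => j _.
    rewrite -!comp_assoc (svalP (b_ j)); congr (_ \oc (_ \oc _)).
    by have [_ ->] := sumE _ _ (fun=> 0) _ _ _ (fun j => sval (b_ j)) j piy piy0.
  have [|d bE] := dtri_lift (a := b) FGH'; first by rewrite -cG -comp_assoc -aE.
  by rewrite aE bE comp_assoc GF comp0l.
(* Componentwise lifting gives [a] with [H \oc a = H' \oc b]; the difference [b - c \oc a] then
   factors through [G' = c \oc G]. *)
have csurj w (b : mor w Z') : exists a, b = c \oc a.
  have FHb : fmap S F \oc (H' \oc b) = 0.
    have := dtri_comp0 FGH2; rewrite compNl => /eqP; rewrite oppr_eq0 => /eqP.
    by rewrite comp_assoc => ->; rewrite comp0l.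
  have a_ j : {a : mor w (z j) | fmap S (px j) \oc (H' \oc b) = h j \oc a}.
    apply/cid/(dtri_lift (fgh2 j)); rewrite compNl comp_assoc -fmap_comp.
    have -> : f j \oc px j = py j \oc F.
      have [_] := sumE _ _ (fun=> 0) _ _ _ (fun j => f j \oc px j) j piy piy0.
      move=> <-; rewrite /F; congr (_ \oc _); apply: eq_bigr => l _.
      by rewrite comp_assoc.
    by rewrite fmap_comp -comp_assoc FHb comp0r oppr0.
  pose a := \sum_j iz j \oc sval (a_ j).
  have HaE : H' \oc b = H \oc a.
    rewrite [LHS]SipS [RHS]SipS; apply: eq_bigr => j _; congr (_ \oc _).
    rewrite [RHS]comp_assoc SpH -comp_assoc; apply: etrans (svalP (a_ j)) _.
    congr (_ \oc _).
    by have [_ ->] := sumE _ _ (fun=> 0) _ _ _ (fun j => sval (a_ j)) j piz piz0.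
  have [|d bE] := dtri_lift (a := b - c \oc a) FGH1.
    by rewrite compBr HaE comp_assoc Hc subrr.
  exists (a + G \oc d); rewrite compDr comp_assoc cG -bE.
  by rewrite addrCA subrr addr0.
have [c' c'c cc'] := yoneda_iso cinj csurj.
exists F, G, H.
apply: (dtri_iso (a := idm X) (b := idm Y) (c := c')) FGH'; try exact: is_iso_id.
- by exists c.
- by rewrite comp_idl comp_idr.
- by rewrite comp_idr -cG comp_assoc c'c comp_idl.
- by rewrite fmap_id comp_idl -Hc -comp_assoc cc' comp_idr.
Qed.

Lemma add_cat_sub (R : set C) x : R x -> add_cat R x.
Proof.
move=> Rx; have [z z0] := ex_zero.
exists 1%N, (fun=> x), z, x; split=> //; first exact: dsum1.
exact: zero_biproduct.
Qed.

End Triangulated.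

(** * Index and coindex *)

Section GrothendieckGroup.
Variables (k : fieldType) (C : triangulated_category k).
Implicit Types (x y z c : C) (T : set C).

Lemma K0_additive_ext T (M : zmodType) (a b : {additive K0 T -> M}) :
  (forall X, a (K0_gen X) = b (K0_gen X)) -> a =1 b.
Proof.
move=> ab v; rewrite -(freeg_sumE v) !raddf_sum; apply: eq_bigr => X _.
set n := coeff X v; have -> : << n *g X >> = (K0_gen X : K0 T) *~ n.
  rewrite -scaler_int intz; apply/eqP/freeg_eqP => Y.
  by rewrite coeffZ !coeffU mul1r.
by rewrite !raddfMz ab.
Qed.

Lemma K0_gen_dualE T (X Y : Indec T) : K0_gen_dual X (K0_gen Y) = (X == Y)%:R.
Proof. by rewrite /K0_gen_dual /= /K0_eval /K0_lift liftU scale1r. Qed.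

Lemma K0_lift_gen T (M : lmodType int) (f : Indec T -> M) (X : Indec T) :
  K0_lift f (K0_gen X) = f X.
Proof. by rewrite /K0_lift liftU scale1r. Qed.

Lemma K0_eval_gen T (f : Indec T -> int) (X : Indec T) :
  K0_eval f (K0_gen X) = f X.
Proof. exact: (@K0_lift_gen T int^o). Qed.

Lemma K0_dual_inj T (v w : K0 T) :
  (forall X, K0_gen_dual X v = K0_gen_dual X w) -> v = w.
Proof.
have coE (X : Indec T) : K0_gen_dual X =1 (coeff X : K0 T -> int).
  apply: K0_additive_ext => Y; rewrite K0_gen_dualE.
  by rewrite /= coeffU mul1r eq_sym.
move=> vw; apply/eqP/freeg_eqP => X.
by have := vw X; rewrite !coE.
Qed.

Lemma irepr_indec T (X : Indec T) : indecomposable (sval (irepr X)).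
Proof. exact: (s2valP' (cid2 (Indec_exP X))).1. Qed.

Lemma val_irepr T (X : Indec T) : val X = [set x | isomorphic x (sval (irepr X))].
Proof. exact: (s2valP' (cid2 (Indec_exP X))).2. Qed.

Lemma irepr_iso T (X Y : Indec T) :
  isomorphic (sval (irepr X)) (sval (irepr Y)) <-> X = Y.
Proof.
split=> [XY | ->]; last exact: isomorphic_refl.
by apply: val_inj; rewrite !val_irepr; apply/iso_classE.
Qed.

Lemma irepr_cls T t (Tt : T t) (it : indecomposable t) :
  isomorphic (sval (irepr (indec_cls Tt it))) t.
Proof. by apply/iso_classE; rewrite -val_irepr. Qed.

Lemma irepr_incl T (X : Indec T) :
  isomorphic (sval (irepr (Indec_incl X))) (sval (irepr X)).
Proof. by apply/iso_classE; rewrite -!val_irepr. Qed.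

End GrothendieckGroup.

Section ClusterTilting.
Variables (k : closedFieldType) (C : triangulated_category k).
Hypothesis hKS : krull_schmidt C.
Implicit Types (x y z c d : C) (T U : set C).
Local Notation S := (Sg C).
Local Notation S' := (SgV C).

(** Split one local summand off a Krull-Schmidt decomposition: it is nonzero, so its complement is
    zero. *)
Lemma indec_local x : indecomposable x -> local_end x.
Proof.
move=> [x0 xi]; have [n [X [Xl]]] := hKS x.
case: n X Xl => [|n] X Xl Xx.
  by case: Xx => i [p [_ _]]; rewrite big_ord0 => /esym/x0.
have [c cX] := tri_additive (X \o fintype.lift ord0).
have X0c := dsum_lift0 Xx cX.
case: (xi _ _ X0c) => [/(Xl ord0).1//|c0].
exact: local_end_iso (biproduct_zero_iso c0 X0c) (Xl ord0).
Qed.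

Lemma irepr_local T (X : Indec T) : local_end (sval (irepr X)).
Proof. exact/indec_local/irepr_indec. Qed.

(** * Classes, coindex and index for one cluster tilting subcategory *)

Section OneSubcategory.
Variable T : set C.
Hypothesis hT : cluster_tilting T.

Lemma ct_rigid t t' (f : mor t (S t')) : T t -> T t' -> f = 0.
Proof. by have [_ _ _ e] := hT; move=> + Tt'; rewrite {1}e; apply. Qed.

Lemma ct_rigidV t t' (f : mor (S' t) t') : T t -> T t' -> f = 0.
Proof.
move=> Tt Tt'; have [c [ci _]] := SgVK C; have [c' c'c _] := ci t.
apply: Sg_inj; rewrite linear0 -(comp_idr (fmap S f)) -c'c comp_assoc.
by rewrite (ct_rigid (fmap S f \oc c') Tt Tt') comp0l.
Qed.

Lemma ct_mem c : (forall t, T t -> forall f : mor c (S t), f = 0) -> T c.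
Proof. by have [_ _ _ e] := hT; rewrite {2}e. Qed.

Lemma ct_retract x c (i : mor x c) (p : mor c x) : p \oc i = idm x -> T c -> T x.
Proof.
move=> pi Tc; apply: ct_mem => t Tt f.
by rewrite -(comp_idr f) -pi comp_assoc (ct_rigid (f \oc p)) // comp0l.
Qed.

Lemma ct_dsum n (X : 'I_n -> C) c : (forall j, T (X j)) -> is_dsum X c -> T c.
Proof.
move=> TX [i [p [_ _ ip]]]; apply: ct_mem => t Tt f.
rewrite -(comp_idr f) -ip comp_sumr big1 // => j _.
by rewrite comp_assoc (ct_rigid (f \oc i j)) // comp0l.
Qed.

Lemma ct_biproduct x y c : T x -> T y -> is_biproduct x y c -> T c.
Proof.
by move=> Tx Ty /biproduct_dsum; apply: ct_dsum => -[[|n]].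
Qed.

Lemma ct_decomp c : T c ->
  exists n (X : 'I_n -> Indec T), is_dsum (fun j => sval (irepr (X j))) c.
Proof.
move=> Tc; have [n [X [Xl Xc]]] := hKS c.
have TX j : T (X j).
  by case: Xc => i [p [pi _ _]]; apply: ct_retract (pi j) Tc.
exists n, (fun j => indec_cls (TX j) (local_end_indec (Xl j))).
apply: dsum_iso Xc; last exact: isomorphic_refl.
by move=> j; apply: isomorphic_sym; exact: irepr_cls.
Qed.

Lemma dual_mult n (X : 'I_n -> Indec T) c (Z : Indec T) :
  is_dsum (fun j => sval (irepr (X j))) c ->
  K0_gen_dual Z (\sum_j K0_gen (X j)) = (mult (sval (irepr Z)) c)%:R.
Proof.
move=> Xc; rewrite (mult_dsum (irepr_local Z) Xc) raddf_sum natr_sum.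
apply: eq_bigr => j _; rewrite K0_gen_dualE mult_local; try exact: irepr_local.
by congr (nat_of_bool _)%:R; apply/eqP/asboolP => /irepr_iso.
Qed.

(** The coefficients are multiplicities in [c], so they do not depend on the decomposition. *)
Lemma K0_clsE n (X : 'I_n -> Indec T) c :
  is_dsum (fun j => sval (irepr (X j))) c -> K0_cls T c = \sum_j K0_gen (X j).
Proof.
move=> Xc; rewrite /K0_cls; set P := (P in xget _ P).
have [|m [Y [Yc ->]]] := @xgetPex _ 0 P; first by exists (\sum_j K0_gen (X j)), n, X.
by apply: K0_dual_inj => Z; rewrite (dual_mult Z Xc) (dual_mult Z Yc).
Qed.

Lemma dual_K0_cls c (Z : Indec T) : T c ->
  K0_gen_dual Z (K0_cls T c) = (mult (sval (irepr Z)) c)%:R.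
Proof. by move=> /ct_decomp[n [X Xc]]; rewrite (K0_clsE Xc); exact: dual_mult. Qed.

Lemma K0_cls_irepr (X : Indec T) : K0_cls T (sval (irepr X)) = K0_gen X.
Proof. by rewrite (K0_clsE (X := fun _ : 'I_1 => X)) ?big_ord1 //; exact: dsum1. Qed.

Lemma K0_cls_dsum n (X : 'I_n -> C) c : (forall j, T (X j)) -> is_dsum X c ->
  K0_cls T c = \sum_j K0_cls T (X j).
Proof.
move=> TX Xc; apply: K0_dual_inj => Z; rewrite raddf_sum.
rewrite dual_K0_cls; last exact: ct_dsum Xc.
rewrite (mult_dsum (irepr_local Z) Xc) natr_sum; apply: eq_bigr => j _.
by rewrite dual_K0_cls.
Qed.

Lemma K0_cls_biproduct x y c : T x -> T y -> is_biproduct x y c ->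
  K0_cls T c = K0_cls T x + K0_cls T y.
Proof.
move=> Tx Ty /biproduct_dsum xyc; rewrite (K0_cls_dsum _ xyc).
  by rewrite big_ord_recl big_ord1.
by case=> -[|n].
Qed.

(** The octahedron on [S' u1 -> a -> b] yields a triangle [u0 -> y -> v -> S u0]. Its last map
    vanishes by rigidity, so [y] is the biproduct of [u0] and [v]. *)
Lemma approx_ext a b v u0 u1 (f : mor a b) (g : mor b v) (h : mor v (S a))
    (al : mor a u0) (be : mor u0 u1) (ga : mor u1 (S a)) :
  T v -> T u0 -> dtri C f g h -> dtri C al be ga ->
  exists y (al' : mor b y) (be' : mor y u1) ga',
    is_biproduct u0 v y /\ dtri C al' be' ga'.
Proof.
move=> Tv Tu0 fgh /dtri_unrot[al0 [be0 [e [[e' e'e ee'] _ tri0]]]].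
have [y [h1 [h2 trih]]] := dtri_cone (f \oc al0).
have [p [q [+ _ _ _ _]]] := dtri_octahedral tri0 fgh trih.
rewrite (ct_rigid (fmap S al \oc h)) // => /dtri_split u0vy.
exists y, h1, (e \oc h2), (- fmap S (f \oc al0) \oc e'); split=> //.
apply: (dtri_iso (a := idm b) (b := idm y) (c := e)) ((dtri_rot _ _ _).1 trih).
- exact: is_iso_id.
- exact: is_iso_id.
- by exists e'.
- by rewrite comp_idl comp_idr.
- by rewrite comp_idr.
- by rewrite fmap_id comp_idl -comp_assoc e'e comp_idr.
Qed.

(** The cone of a left approximation [al] lies in [T]: a map [u1 -> S t] vanishes on [u0] by
    rigidity, hence factors through [ga] and then through [fmap S al \oc ga = 0]. *)
Lemma coind_triangle c : exists u0 u1 (al : mor c u0) (be : mor u0 u1) ga,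
  [/\ T u0, T u1 & dtri C al be ga].
Proof.
have [_ /(_ c)[_ [u0 [al [Tu0 alP]]]] _ _] := hT.
have [u1 [be [ga tri]]] := dtri_cone al; exists u0, u1, al, be, ga; split=> //.
have tri1 := (dtri_rot _ _ _).1 tri; have tri2 := (dtri_rot _ _ _).1 tri1.
apply: ct_mem => t Tt f; have [|b ->] := dtri_extend (a := f) tri1.
  exact: ct_rigid.
have [b' ->] := Sg_full b; have [a ->] := alP _ b' Tt.
have := dtri_comp0 tri2; rewrite compNl => /eqP; rewrite oppr_eq0 => /eqP alga.
by rewrite fmap_comp -comp_assoc alga comp0r.
Qed.

(** Schanuel's argument: for a second coresolution [c -> v0 -> v1], the object [y] of [approx_ext]
    is both [u0] plus [v1] and, by rigidity, [v0] plus [u1]. *)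
Lemma coindE c u0 u1 (al : mor c u0) (be : mor u0 u1) ga :
  T u0 -> T u1 -> dtri C al be ga -> coind T c = K0_cls T u0 - K0_cls T u1.
Proof.
move=> Tu0 Tu1 tri; rewrite /coind; set P := (P in xget _ P).
have [|v0 [v1 [f [g [h [Tv0 Tv1 fgh ->]]]]]] := @xgetPex _ 0 P.
  by exists (K0_cls T u0 - K0_cls T u1), u0, u1, al, be, ga.
have [y [al' [be' [ga' [u0v1y]]]]] := approx_ext Tv1 Tu0 fgh tri.
rewrite (ct_rigid ga') // => /dtri_split v0u1y.
have := K0_cls_biproduct Tu0 Tv1 u0v1y; rewrite (K0_cls_biproduct Tv0 Tu1 v0u1y).
by move=> e; apply/eqP; rewrite subr_eq addrAC -e addrK.
Qed.

Lemma coind_ext a b v (f : mor a b) (g : mor b v) (h : mor v (S a)) :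
  T v -> dtri C f g h -> coind T b = coind T a + K0_cls T v.
Proof.
move=> Tv fgh; have [u0 [u1 [al [be [ga [Tu0 Tu1 tri]]]]]] := coind_triangle a.
have [y [al' [be' [ga' [u0vy tri']]]]] := approx_ext Tv Tu0 fgh tri.
rewrite (coindE Tu0 Tu1 tri) (coindE _ Tu1 tri').
  by rewrite (K0_cls_biproduct Tu0 Tv u0vy) addrAC.
exact: ct_biproduct u0vy.
Qed.

Lemma coind_dsum n (X : 'I_n -> C) c : is_dsum X c ->
  coind T c = \sum_j coind T (X j).
Proof.
move=> Xc.
(* For each [j] a coresolution is packed into one dependent pair, so that a single choice provides
   its objects and its maps. *)
have tri j : {t : {u : C * C &
      (mor (X j) u.1 * mor u.1 u.2 * mor u.2 (S (X j)))%type} |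
    let: existT u (f, g, h) := t in [/\ T u.1, T u.2 & dtri C f g h]}.
  apply: cid; have [u0 [u1 [al [be [ga h]]]]] := coind_triangle (X j).
  by exists (existT _ (u0, u1) (al, be, ga)).
pose u0 j := (tag (sval (tri j))).1; pose u1 j := (tag (sval (tri j))).2.
have [al [be [ga triE]]] : exists (al : forall j, mor (X j) (u0 j))
    (be : forall j, mor (u0 j) (u1 j)) (ga : forall j, mor (u1 j) (S (X j))),
    forall j, [/\ T (u0 j), T (u1 j) & dtri C (al j) (be j) (ga j)].
  exists (fun j => (tagged (sval (tri j))).1.1), (fun j => (tagged (sval (tri j))).1.2).
  exists (fun j => (tagged (sval (tri j))).2) => j; rewrite /u0 /u1.
  by case: (tri j) => -[[? ?] [[? ?] ?]].
have [Y0 Y0E] := tri_additive u0; have [Y1 Y1E] := tri_additive u1.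
have [al' [be' [ga' tri']]] :=
  dtri_dsum (fun j => let: And3 _ _ t := triE j in t) Xc Y0E Y1E.
have Tu0 j : T (u0 j) by case: (triE j).
have Tu1 j : T (u1 j) by case: (triE j).
rewrite (coindE (ct_dsum Tu0 Y0E) (ct_dsum Tu1 Y1E) tri').
rewrite (K0_cls_dsum Tu0 Y0E) (K0_cls_dsum Tu1 Y1E) -sumrB; apply: eq_bigr => j _.
by case: (triE j) => _ _ /coindE->.
Qed.

Lemma coind_iso x y : isomorphic x y -> coind T x = coind T y.
Proof.
move=> xy; have := dsum_iso (fun=> isomorphic_refl x) xy (dsum1 x).
by move/coind_dsum->; rewrite big_ord1.
Qed.

Lemma ind_triangle s : exists t1 t0 (f : mor t1 t0) (g : mor t0 s) h,
  [/\ T t1, T t0 & dtri C f g h].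
Proof.
have [t1 [t0 [al [be [ga [Tt1 Tt0 tri]]]]]] := coind_triangle (S' s).
have [e [ei _]] := SgVK C; have [e' e'e ee'] := ei s.
exists t1, t0, be, (e s \oc ga), (- fmap S al \oc e'); split=> //.
apply: (dtri_iso (a := idm t1) (b := idm t0) (c := e s)) ((dtri_rot _ _ _).1 tri).
- exact: is_iso_id.
- exact: is_iso_id.
- by exists e'.
- by rewrite comp_idl comp_idr.
- by rewrite comp_idr.
- by rewrite fmap_id comp_idl -comp_assoc e'e comp_idr.
Qed.

Lemma ind_coind s : ind T s = - coind T (S' s).
Proof.
rewrite /ind; set P := (P in xget _ P).
have [|t1 [t0 [f [g [h [Tt1 Tt0 fgh ->]]]]]] := @xgetPex _ 0 P.
  have [t1 [t0 [f [g [h [Tt1 Tt0 fgh]]]]]] := ind_triangle s.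
  by exists (K0_cls T t0 - K0_cls T t1), t1, t0, f, g, h.
have [f' [g' [e [_ _ tri]]]] := dtri_unrot fgh.
by rewrite (coindE Tt1 Tt0 tri) opprB.
Qed.

Lemma indE t1 t0 s (f : mor t1 t0) (g : mor t0 s) h :
  T t1 -> T t0 -> dtri C f g h -> ind T s = K0_cls T t0 - K0_cls T t1.
Proof.
move=> Tt1 Tt0 fgh; have [f' [g' [e [_ _ tri]]]] := dtri_unrot fgh.
by rewrite ind_coind (coindE Tt1 Tt0 tri) opprB.
Qed.

Lemma ind_dsum n (X : 'I_n -> C) c : is_dsum X c -> ind T c = \sum_j ind T (X j).
Proof.
move=> [i [p [pi pi0 ip]]]; rewrite ind_coind (@coind_dsum _ (fun j => S' (X j))).
  by rewrite -sumrN; apply: eq_bigr => j _; rewrite ind_coind.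
exists (fun j => fmap S' (i j)), (fun j => fmap S' (p j)); split.
- by move=> j; rewrite -fmap_comp pi fmap_id.
- by move=> j l jl; rewrite -fmap_comp pi0 // linear0.
- rewrite -fmap_id -ip linear_sum; apply: eq_bigr => j _.
  by rewrite -fmap_comp.
Qed.

End OneSubcategory.

(** * Index and coindex as mutually inverse maps *)

Section TwoSubcategories.
Variables T U : set C.
Hypotheses (hT : cluster_tilting T) (hU : cluster_tilting U).

Lemma coind_hom_cls t : T t -> coind_hom U (K0_incl T (K0_cls T t)) = coind U t.
Proof.
move=> /(ct_decomp hT)[n [X Xt]]; rewrite (K0_clsE Xt) !raddf_sum (coind_dsum hU Xt).
apply: eq_bigr => j _; rewrite /K0_incl /coind_hom /= !K0_lift_gen.
by apply: (coind_iso hU); exact: irepr_incl.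
Qed.

Lemma coind_hom_ind v : U v -> coind_hom U (K0_incl T (ind T v)) = K0_cls U v.
Proof.
move=> Uv; have [t1 [t0 [f [g [h [Tt1 Tt0 fgh]]]]]] := ind_triangle hT v.
rewrite (indE hT Tt1 Tt0 fgh) !raddfB !coind_hom_cls // (coind_ext hU Uv fgh).
by rewrite addrAC subrr add0r.
Qed.

(** Rotating back twice gives [S' u0 -> S' u1 -> t], to which [coind_ext] applies. Thus the indices
    of objects of [U] generate [K0 T]. *)
Lemma ind_coind_triangle t u0 u1 (al : mor t u0) (be : mor u0 u1) ga :
  T t -> dtri C al be ga -> K0_cls T t = ind T u0 - ind T u1.
Proof.
move=> Tt /dtri_unrot[f [g [_ [_ _ /dtri_unrot[f' [g' [_ [_ _ tri]]]]]]]].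
by rewrite !ind_coind // (coind_ext hT Tt tri) opprK addKr.
Qed.

Lemma K0_dual_ind_ext (a b : Zdual (K0 T)) :
  (forall v : Indec U, a (ind T (sval (irepr v))) = b (ind T (sval (irepr v)))) ->
  a =1 b.
Proof.
move=> ab; have abU u : U u -> a (ind T u) = b (ind T u).
  move=> /(ct_decomp hU)[n [X Xu]]; rewrite (ind_dsum hT Xu) !raddf_sum.
  by apply: eq_bigr.
apply: K0_additive_ext => X; rewrite -(K0_cls_irepr X).
have [u0 [u1 [al [be [ga [Uu0 Uu1 tri]]]]]] := coind_triangle hU (sval (irepr X)).
by rewrite (ind_coind_triangle (svalP (irepr X)) tri) !raddfB !abU.
Qed.

(** The right-hand side has the defining property by [coind_hom_ind], and [K0_dual_ind_ext] makes
    that property determine the functional. *)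
Lemma cvectorE (u : Indec U) :
  cvector T u =1 K0_gen_dual u \o (coind_hom U \o K0_incl T).
Proof.
pose c : Zdual (K0 T) := K0_gen_dual u \o (coind_hom U \o K0_incl T).
have cP (v : Indec U) : c (ind T (sval (irepr v))) = (u == v)%:R.
  by rewrite -K0_gen_dualE -K0_cls_irepr -(coind_hom_ind (svalP (irepr v))).
apply: (@K0_dual_ind_ext _ c) => v; rewrite cP /cvector.
set P := (P in xget _ P).
exact: (@xgetPex _ _ P (ex_intro _ c cP)).
Qed.

End TwoSubcategories.

End ClusterTilting.

(** * Exchange triangles *)

Lemma dim_linear_bij (k : fieldType) (V W : vectType k) (f : V -> W) :
  linear f -> bijective f -> dim V = dim W.
Proof.
move=> fl [g fK gK].
pose F : {linear V -> W} := HB.pack f (GRing.isLinear.Build k V W *:%R f fl).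
have FE v : linfun F v = f v by rewrite lfunE.
rewrite -!dimvf -(limg_dim_eq (f := linfun F)); last first.
  apply/eqP; rewrite -subv0; apply/subvP => v; rewrite memv_cap memv_ker memv0 => /andP[_].
  by rewrite FE => /eqP fv0; rewrite -(fK v) fv0 -[0]/(0 : W) -(linear0 F) fK.
congr (\dim _); apply/vspaceP => w; rewrite memvf.
by apply/memv_imgP; exists (g w); rewrite ?memvf // FE gK.
Qed.

Section HomDimension.
Variables (k : closedFieldType) (C : triangulated_category k).
Implicit Types (x y w c : C).

Lemma dim_hom_dsum n (X : 'I_n -> C) c w : is_dsum X c ->
  dim (mor c w) = (\sum_j dim (mor (X j) w))%N.
Proof.
move=> [i [p [pi pi0 ip]]]; rewrite -dimvf.
rewrite (@dim_dsum _ _ _ _ _ (fun j => fullv) (fun j => linfun (precomp (p j)))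
  (fun j => linfun (precomp (i j)))); first by apply: eq_bigr => j _; rewrite dimvf.
- by move=> j v; rewrite !lfunE /= /precomp -comp_assoc pi comp_idr.
- by move=> j l v jl; rewrite !lfunE /= /precomp -comp_assoc pi0 1?eq_sym // comp0r.
- move=> v; rewrite -[RHS]comp_idr -ip comp_sumr; apply: eq_bigr => j _.
  by rewrite !lfunE /= /precomp comp_assoc.
- by move=> *; rewrite memvf.
- by move=> *; rewrite memvf.
Qed.

Lemma dim_hom_iso x y w : isomorphic x y -> dim (mor x w) = dim (mor y w).
Proof.
move=> xy; have := dsum_iso (fun=> isomorphic_refl x) xy (dsum1 x).
by move/(dim_hom_dsum w)->; rewrite big_ord1.
Qed.

Lemma local_rad x (f : mor x x) : local_end x -> Defs.rad f <-> ~ is_iso f.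
Proof.
move=> xl; split=> [fr [g gf fg]|fn g].
  by apply: (not_iso0 xl.1); rewrite -(subrr (idm x)) -{2}gf; exact: fr.
by case: (xl.2 (g \oc f)) => // /(local_retract xl.1 xl)/fn.
Qed.

(** Meant for [i] and [p] the inclusion and projection of a copy of [x] in [z]. If [a] inverts
    [h \oc i], the invertible map [idm z - i \oc a \oc h] kills [i]; the case of [p \oc g] is
    similar. *)
Lemma local_rad_comp x z (g : mor x z) (h : mor z x) (i : mor x z) (p : mor z x) :
  local_end x -> Defs.rad g -> Defs.rad h -> ~ is_iso (h \oc i) /\ ~ is_iso (p \oc g).
Proof.
move=> xl gr hr; split=> [[a ahi _]|[a apg _]].
  have [b bE _] := hr (i \oc a).
  apply: xl.1; rewrite /is_zero -ahi -[i]comp_idl -bE -!comp_assoc compBl comp_idl.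
  by rewrite -!comp_assoc ahi comp_idr subrr !comp0r.
have := gr (a \oc p); rewrite -comp_assoc apg subrr.
exact: not_iso0 xl.1.
Qed.

End HomDimension.

Section Nakayama.
Variables (k : closedFieldType) (C : linear_category k).
Variables (w c : C) (d : mor w c).
Hypothesis wl : local_end w.

(* Nakayama's lemma for the right [End w]-module [d \oc rad w w]: pass to a
   maximal submodule [W] of [Hom(w, c)] that does not contain it. *)
Lemma rad_nakayama :
  (forall (W : {vspace mor w c}) (r : mor w w), ~ is_iso r -> d \oc r \notin W ->
    exists q s : mor w w, [/\ ~ is_iso q, ~ is_iso s & d \oc q \oc s \notin W]) ->
  forall r : mor w w, ~ is_iso r -> d \oc r = 0.
Proof.
move=> step r0 r0n; apply/eqP; apply: contraT => dr0.
pose stable (W : {vspace mor w c}) := forall v (a : mor w w), v \in W -> v \oc a \in W.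
pose Q n := `[< exists W,
  [/\ stable W, exists2 r, ~ is_iso r & d \oc r \notin W & \dim W = n] >].
have Q0 : exists n, Q n.
  exists 0%N; apply/asboolP; exists 0%VS; split; last exact: dimv0.
    by move=> v a; rewrite !memv0 => /eqP ->; rewrite comp0l.
  by exists r0 => //; rewrite memv0.
have Qmax n : Q n -> (n <= dim (mor w c))%N.
  by move=> /asboolP[W [_ _ <-]]; rewrite -dimvf; exact/dimvS/subvf.
case: (ex_maxnP Q0 Qmax) => n /asboolP[W [Wst [r rn drW] dW]] nmax.
have [q [s [qn sn dqsW]]] := step W r rn drW.
pose W1 := (W + limg (linfun (mcomp (d \oc q \oc s) : mor w w -> _)))%VS.
have dqs1 : d \oc q \oc s \in W1.
  apply: (subvP (addvSr _ _)); apply/memv_imgP; exists (idm w); first exact: memvf.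
  by rewrite lfunE /= comp_idr.
have W1st : stable W1.
  move=> v a /memv_addP[v1 v1W [v2 /memv_imgP[b _ ->] ->]].
  rewrite compDl memv_add ?Wst // lfunE /= -comp_assoc; apply/memv_imgP.
  by exists (b \oc a); rewrite ?memvf // lfunE.
(* [W1] is stable and properly contains [W], so by maximality it contains every [d \oc r] with [r]
   not invertible. *)
have dq1 : d \oc q \in W1.
  apply: contraT => dq1; have /nmax : Q (\dim W1).
    by apply/asboolP; exists W1; split=> //; exists q.
  rewrite -dW => dle; have := eqEdim W W1.
  by rewrite addvSl dle /= => /eqP WW1; rewrite -WW1 (negPf dqsW) in dqs1.
have [v vW [_ /memv_imgP[a _ ->]]] := memv_addP dq1.
rewrite lfunE /= => dqE.
(* Modulo [W], [d \oc q] equals [d \oc q \oc s \oc a]. As [s] is not invertible, [idm w - s \oc a]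
   is, which puts [d \oc q] in [W], a contradiction. *)
have : is_iso (idm w - s \oc a).
  case: (wl.2 (s \oc a)) => // sai; case: sn.
  exact: is_iso_cancel_r (local_retract wl.1 wl sai) sai.
move=> [b _ sab]; case/negP: dqsW; apply: (Wst _ s).
rewrite -(comp_idr (d \oc q)) -sab comp_assoc; apply: Wst.
by rewrite compBr comp_idr comp_assoc {1}dqE addrK.
Qed.

End Nakayama.

(** * The connecting map of an exchange triangle and the sign of the c-vector *)

Section Exchange.
Variables (k : closedFieldType) (C : triangulated_category k).
Hypotheses (hKS : krull_schmidt C) (hCY : calabi_yau2 C).
Variables (T U : set C).
Hypotheses (hT : cluster_tilting T) (hU : cluster_tilting U) (hloop : no_loops U).
Variables (u : C) (Uu : U u) (iu : indecomposable u).
Variables (u' e : C) (f : mor u' e) (g : mor e u) (d : mor u (Sg C u')).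
Hypotheses (hmut : is_mutation U u u') (hex : exchange_triangle U f g d).
Implicit Types (x y z c : C).

Local Notation S := (Sg C).
(** The quiver and [K0 U] use the chosen representative [w] of the class [X0], which is isomorphic
    to [u] but need not equal it. *)
Let X0 : Indec U := indec_cls Uu iu.
Let w : C := sval (irepr X0).

Lemma add_cat_ct (R : set C) x : (forall y, R y -> U y) -> add_cat R x -> U x.
Proof.
move=> RU [n [X [y [s [RX Xs [i [_ [p [_ [pi _ _ _ _]]]]]]]]]].
apply: (ct_retract hU pi); apply: ct_dsum Xs => // j; exact: RU.
Qed.

Lemma U_e : U e.
Proof. by case: hex => _ _ [[+ _] _]; apply: add_cat_ct => y []. Qed.

(** Both [x] and [u'] lie in the mutated subcategory, which is rigid. *)
Lemma hom_minus x (a : mor x (S u')) : Indec_minus U u x -> a = 0.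
Proof.
move=> xR; case: hmut => _ _ hU'; apply: (ct_rigid hU'); apply: add_cat_sub.
  by left.
by right.
Qed.

Lemma minus_or_cls (X : Indec U) : X <> X0 -> Indec_minus U u (sval (irepr X)).
Proof.
move=> XX0; split; [exact: svalP | exact: irepr_indec |] => Xu; apply: XX0.
apply/irepr_iso; apply: isomorphic_trans Xu _; apply: isomorphic_sym.
exact: irepr_cls.
Qed.

Lemma rad_span_rad2 (r : mor w w) :
  ~ is_iso r -> r \in vspan (rad2 U (x := w) (y := w)).
Proof.
have wl := irepr_local hKS X0.
move=> /(local_rad _ wl) rr.
have sub : (vspan (rad2 U (x := w) (y := w)) <= vspan (@Defs.rad _ _ w w))%VS.
  apply: (vspanP _).2 => _ [z [a [b [_ ar br ->]]]]; apply: (vspanP _).1 => c.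
  by rewrite comp_assoc; exact: ar.
(* [arrows] is a truncated difference, so its vanishing gives only an inequality of dimensions; the
   inclusion [sub] turns it into equality of the two spans. *)
have /eqP : (arrows X0 X0 = 0)%N by exact: hloop.
rewrite subn_eq0 => dle.
have := eqEdim (vspan (rad2 U (x := w) (y := w))) (vspan (@Defs.rad _ _ w w)).
by rewrite sub dle /= => /eqP->; apply: (vspanP _).1.
Qed.

(** Without loops [r] is a combination of composites [w -> z -> w] of radical maps. Summands of [z]
    other than [w] contribute nothing by [hom_minus], and copies of [w] contribute products of two
    non-isomorphisms, as [rad_nakayama] requires. *)
Lemma rad_annihilates (th : mor w u) (r : mor w w) : ~ is_iso r -> d \oc th \oc r = 0.
Proof.
have wl := irepr_local hKS X0.
move: r; apply: (rad_nakayama wl) => W r rn drW.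
have [v [z [a [b [Uz ar br ->]]]] dvW] : exists2 v, rad2 U v & d \oc th \oc v \notin W.
  apply: contrapT => no; case/negP: drW.
  suff /subvP/(_ r (rad_span_rad2 rn)) :
      (vspan (rad2 U (x := w) (y := w)) <=
       linfun (mcomp (d \oc th) : mor w w -> _) @^-1: W)%VS.
    by rewrite -memv_preim lfunE.
  apply: (vspanP _).2 => v vr; rewrite -memv_preim lfunE /=.
  by apply: contraT => dvW; case: no; exists v.
have [n [X [i [p [_ _ ip]]]]] := ct_decomp hKS hU Uz.
have [j] : exists j, d \oc th \oc (b \oc i j) \oc (p j \oc a) \notin W.
  apply: contrapT => no; case/negP: dvW.
  rewrite -(comp_idl a) -ip comp_suml !comp_sumr; apply: rpred_sum => j _.
  apply: contraT => jW; case: no; exists j; apply: contra jW.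
  by rewrite !comp_assoc.
have [XjE|XjN] := EM (X j = X0); last first.
  have -> : d \oc th \oc (b \oc i j) = 0 by apply/hom_minus/minus_or_cls.
  by rewrite comp0l mem0v.
move: (i j) (p j); rewrite XjE => ij pj dW.
have [bin pan] := local_rad_comp ij pj wl ar br.
by exists (b \oc ij), (pj \oc a).
Qed.

Lemma lift_d x (a : mor x (S u')) : U x -> exists b, a = d \oc b.
Proof.
move=> Ux; have [tri _ _] := hex.
apply: dtri_lift ((dtri_rot _ _ _).1 ((dtri_rot _ _ _).1 tri)) _.
exact: (ct_rigid hU) Ux U_e.
Qed.

(** Lift [a] to [d \oc b]; up to transport to [w], [b] is a scalar plus a non-isomorphism, and [d]
    kills the latter. *)
Lemma hom_u_span (a : mor u (S u')) : exists l, a = l *: d.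
Proof.
have wl := irepr_local hKS X0.
have [th [th' [th'th thth']]] := isomorphicT (irepr_cls Uu iu).
have [b ->] := lift_d a Uu.
have [l lP] := local_residue (th' \oc b \oc th) wl.
exists l; have := rad_annihilates th lP.
rewrite compBr compZr comp_idr !comp_assoc -(comp_assoc d) thth' comp_idr.
move=> /(congr1 (fun h => h \oc th')).
rewrite compBl compZl -!(comp_assoc _ th) thth' !comp_idr comp0l => /eqP.
by rewrite subr_eq0 => /eqP.
Qed.

(** Otherwise [idm u] would factor through [e], hence through indecomposables not isomorphic to [u],
    and would be radical. *)
Lemma d_neq0 : d != 0.
Proof.
have ul := indec_local hKS iu; have [tri _ [[eR _] _]] := hex.
apply/eqP => d0; have [|h hE] := dtri_lift (a := idm u) ((dtri_rot _ _ _).1 tri).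
  by rewrite d0 comp0l.
have [n [X [y [s [RX [i [p [pi pi0 ip]]] [i' [_ [p' [_ [pi' _ _ _ _]]]]]]]]]] := eR.
suff : idm u \in Rad u u.
  by move=> /(mem_Rad _ ul)/(_ (idm u)); rewrite comp_idl; apply; exact: is_iso_id.
have -> : idm u = \sum_j (g \oc p' \oc i j) \oc (p j \oc i' \oc h).
  rewrite hE -{1}(comp_idl h) -pi' -{1}(comp_idr p') -ip comp_sumr !comp_suml comp_sumr.
  by apply: eq_bigr => j _; rewrite !comp_assoc.
apply: rpred_sum => j _; apply/(mem_Rad _ ul) => a; rewrite comp_assoc => iso.
have [_ Xji Xju] := RX j; apply: Xju; apply: isomorphic_sym.
exists (p j \oc i' \oc h); apply: local_retract iso; first exact: ul.1.
exact: indec_local.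
Qed.

Lemma dim_hom_u : dim (mor u (S u')) = 1%N.
Proof.
rewrite -dimvf (_ : fullv = <[d]>%VS) ?dim_vline ?d_neq0 //.
apply/eqP; rewrite eqEsubv subvf andbT; apply/subvP => a _.
by have [l ->] := hom_u_span a; rewrite rpredZ ?memv_line.
Qed.

Lemma dual_dim_hom x : U x -> K0_gen_dual X0 (K0_cls U x) = (dim (mor x (S u')))%:R.
Proof.
move=> /(ct_decomp hKS hU)[n [X Xx]].
rewrite (K0_clsE hKS Xx) (dim_hom_dsum _ Xx) raddf_sum natr_sum; apply: eq_bigr => j _.
rewrite K0_gen_dualE; have [<-|XN] := eqVneq.
  by rewrite (dim_hom_iso _ (irepr_cls Uu iu)) dim_hom_u.
suff -> : dim (mor (sval (irepr (X j))) (S u')) = 0%N by [].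
apply/eqP; rewrite -dimvf dimv_eq0 -subv0; apply/subvP => a _.
by rewrite memv0; apply/eqP/hom_minus/minus_or_cls/eqP; rewrite eq_sym.
Qed.

Lemma cy_dim x y : dim (mor x y) = dim (mor y (S (S x))).
Proof.
have [phi [phil phib _]] := hCY.
have -> := dim_linear_bij (phil x y) (phib x y).
by rewrite -[RHS]muln1.
Qed.

(* By Serre duality some [y : Sg u' -> Sg^2 t] has [Sg^2 a \oc y != 0]. As
   [Hom(Sg u', Sg^2 u)] is dual to [Hom(u, Sg u') = k d], every map
   [Sg u' -> Sg^2 u] is a multiple of [Sg^2 a \oc y]. *)
Lemma hom_u_factor t (a : mor t u) : d \oc a != 0 ->
  exists y : mor (S u') (S (S t)),
    forall h : mor (S u') (S (S u)), exists l, h = l *: (fmap S (fmap S a) \oc y).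
Proof.
have [phi [phil phib phin]] := hCY => da0.
pose L : {linear mor t (S u') -> 'Hom(mor (S u') (S (S t)), k^o)} :=
  HB.pack (phi t (S u')) (GRing.isLinear.Build k _ _ *:%R _ (phil t (S u'))).
have [y yP] : exists y : mor (S u') (S (S t)), phi t (S u') (d \oc a) y != 0.
  apply: contrapT => no; case/negP: da0; apply/eqP.
  apply: (bij_inj (phib t (S u'))); rewrite -[phi _ _ 0]/(L 0) linear0.
  apply/lfunP => y; rewrite lfunE /=; apply/eqP; apply: contraT => yP.
  by case: no; exists y.
exists y => h; set h0 := fmap S (fmap S a) \oc y.
have h00 : h0 != 0.
  apply: contraNneq yP => h00; have := phin _ _ _ _ a (idm (S u')) d y.
  by rewrite comp_idl comp_idr -/h0 h00 linear0 => ->.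
apply/vlineP; suff <- : fullv = <[h0]>%VS by exact: memvf.
apply/eqP; rewrite eq_sym eqEdim subvf dimvf -cy_dim dim_hom_u dim_vline h00.
by [].
Qed.

(** On summands [u] of [x], [h] factors through [y], and [y \oc fmap S b] is zero by rigidity of
    [T]. For every other summand [X j], the maps from [S u'] to its double suspension are dual to
    its maps to [S u'], hence zero. *)
Lemma hom_u'_vanish s t x (a : mor t u) (b : mor s u') (h : mor (S u') (S (S x))) :
  T s -> T t -> U x -> d \oc a != 0 -> h \oc fmap S b = 0.
Proof.
move=> Ts Tt Ux da0; have [y yP] := hom_u_factor da0.
have kill_u (h' : mor (S u') (S (S u))) : h' \oc fmap S b = 0.
  have [l ->] := yP h'; have [y' yE] := Sg_full (y \oc fmap S b).
  by rewrite compZl -comp_assoc yE (ct_rigid hT y' Ts Tt) linear0 comp0r scaler0.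
have [n [X [i [p [_ _ ip]]]]] := ct_decomp hKS hU Ux.
rewrite -(comp_idl h) -!fmap_id -ip !linear_sum !comp_suml big1 // => j _.
rewrite /= !fmap_comp -!comp_assoc; set h' := fmap S (fmap S (p j)) \oc _.
suff -> : h' = 0 by rewrite comp0r.
rewrite /h' comp_assoc; have [XjE|XjN] := EM (X j = X0).
  move: (p j); rewrite XjE => q.
  have [th [th' [th'th _]]] := isomorphicT (irepr_cls Uu iu).
  rewrite -(comp_idl q) -th'th !fmap_comp -!comp_assoc.
  by rewrite (comp_assoc _ h) (comp_assoc _ _ (fmap S b)) kill_u comp0r.
have xj0 : dim (mor (S u') (S (S (sval (irepr (X j)))))) = 0%N.
  apply/eqP; rewrite -cy_dim -dimvf dimv_eq0 -subv0; apply/subvP => c _.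
  by rewrite memv0; apply/eqP/hom_minus/minus_or_cls.
have -> : fmap S (fmap S (p j)) \oc h = 0; last by rewrite comp0l.
apply/eqP; rewrite -memv0; move/eqP: xj0; rewrite -dimvf dimv_eq0 => /eqP <-.
exact: memvf.
Qed.

(** By naturality the functional of [fmap S b \oc c] at [h] is that of [c] at
    [h \oc fmap S b = 0]. *)
Lemma hom_Sgu'_vanish s t x (a : mor t u) (b : mor s u') (c : mor x (S s)) :
  T s -> T t -> U x -> d \oc a != 0 -> fmap S b \oc c = 0.
Proof.
move=> Ts Tt Ux da0; have [phi [phil phib phin]] := hCY.
pose L : {linear mor x (S u') -> 'Hom(mor (S u') (S (S x)), k^o)} :=
  HB.pack (phi x (S u')) (GRing.isLinear.Build k _ _ *:%R _ (phil x (S u'))).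
apply: (bij_inj (phib x (S u'))); rewrite -[phi _ _ 0]/(L 0) linear0.
apply/lfunP => h; have := phin _ _ _ _ (idm x) (fmap S b) c h.
rewrite !fmap_id comp_idl comp_idr => ->.
by rewrite (hom_u'_vanish b h Ts Tt Ux da0) linear0 lfunE.
Qed.

(** Rank and nullity for [A] and [B], with exactness at the middle term cancelling [lker A] against
    [limg B]. *)
Lemma dual_coind t u0 u1 (al : mor t u0) (be : mor u0 u1) ga :
  U u0 -> U u1 -> dtri C al be ga ->
  K0_gen_dual X0 (coind U t) =
    (\dim (limg (linfun (mcomp d : mor t u -> mor t (S u')))))%:R -
    (\dim (lker (linfun (precomp be : mor u1 (S u') -> mor u0 (S u')))))%:R.
Proof.
move=> Uu0 Uu1 tri; rewrite (coindE hKS hU Uu0 Uu1 tri) raddfB !dual_dim_hom //.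
set A := linfun (precomp al : mor u0 (S u') -> mor t (S u')).
set B := linfun (precomp be : mor u1 (S u') -> mor u0 (S u')).
(* A map [t -> u] extends along [al] because maps [S' u1 -> u] vanish; conversely a map [u0 -> S u']
   lifts along [d]. *)
have -> : limg (linfun (mcomp d : mor t u -> mor t (S u'))) = limg A.
  apply/vspaceP => a; apply/memv_imgP/memv_imgP => -[b _ ->].
    have [f' [be' [_ [_ _ tri']]]] := dtri_unrot tri.
    have [|c bE] := dtri_extend (a := b) tri'; first exact: (ct_rigidV hU).
    by exists (d \oc c); rewrite ?memvf // !lfunE /= /precomp bE comp_assoc.
  have [c ->] := lift_d b Uu0.
  by exists (c \oc al); rewrite ?memvf // !lfunE /= /precomp comp_assoc.
have dA := limg_ker_dim A fullv; have dB := limg_ker_dim B fullv.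
rewrite capfv dimvf in dA; rewrite capfv dimvf in dB.
have AB : lker A = limg B.
  apply/vspaceP => a; rewrite memv_ker lfunE /= /precomp.
  apply/eqP/memv_imgP => [aal|[b _ ->]].
    have [b ->] := dtri_extend tri aal.
    by exists b; rewrite ?memvf // lfunE.
  by rewrite lfunE /= /precomp -comp_assoc (dtri_comp0 tri) comp0r.
by rewrite -dA -dB AB !natrD (addrC (\dim (lker B))%:R) opprD addrACA subrr add0r.
Qed.

(** In a triangle [t1 -> t0 -> u -> S t1], if [d] killed [t0 -> u] it would factor through
    [S t1]. *)
Lemma not_factors_d : ~ factors_through (shifts T) d ->
  exists t (a : mor t u), T t /\ d \oc a != 0.
Proof.
move=> nf; have [t1 [t0 [a [b [h [Tt1 Tt0 tri]]]]]] := ind_triangle hT u.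
exists t0, b; split=> //; apply/eqP => db; apply: nf.
have [c dE] := dtri_extend ((dtri_rot _ _ _).1 tri) db.
exists (S t1), h, c; split=> //; exists t1 => //; exact: isomorphic_refl.
Qed.

Lemma factors_d_comp t (a : mor t u) :
  factors_through (shifts T) d -> T t -> d \oc a = 0.
Proof.
move=> [z [b [c [[t1 Tt1 zt1] ->]]]] Tt.
have [q [q' [q'q _]]] := isomorphicT zt1.
rewrite -(comp_idr c) -q'q -!comp_assoc (_ : q \oc (b \oc a) = 0) ?comp0r //.
exact: (ct_rigid hT).
Qed.

Lemma cvector_gen (X : Indec T) :
  cvector T X0 (K0_gen X) = K0_gen_dual X0 (coind U (sval (irepr X))).
Proof.
rewrite (cvectorE hKS hT hU) -(K0_cls_irepr hKS X) /=.
by rewrite -(coind_hom_cls hKS hT hU (svalP (irepr X))).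
Qed.

Lemma cvector_image : ~ factors_through (shifts T) d ->
  cvector T X0 =1 dimvec (timage (yoneda_map T d)).
Proof.
move=> /not_factors_d[t [a [Tt da0]]]; apply: K0_additive_ext => X.
have [u0 [u1 [al [be [ga [Uu0 Uu1 tri]]]]]] := coind_triangle hU (sval (irepr X)).
rewrite cvector_gen (dual_coind Uu0 Uu1 tri).
(* A map killed by [be] has the form [fmap S c' \oc ga], which [hom_Sgu'_vanish] makes zero. *)
rewrite (_ : lker _ = 0%VS); last first.
  apply/eqP; rewrite -subv0; apply/subvP => b; rewrite memv_ker memv0 lfunE /= /precomp.
  move=> /eqP bbe; apply/eqP.
  have [c ->] := dtri_extend ((dtri_rot _ _ _).1 tri) bbe.
  have [c' ->] := Sg_full c.
  exact: hom_Sgu'_vanish (svalP (irepr X)) Tt Uu1 da0.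
by rewrite dimv0 subr0 [RHS]K0_eval_gen dimvf.
Qed.

Lemma cvector_not_positive : factors_through (shifts T) d -> ~ positive (cvector T X0).
Proof.
(* Only the negative term of [dual_coind] survives, so positivity forces every value to be zero. *)
move=> fd pos; have c0 : cvector T X0 =1 (\0 : Zdual (K0 T)).
  apply: K0_additive_ext => X; apply/le_anti.
  rewrite [X in _ && X]pos andbT cvector_gen.
  have [u0 [u1 [al [be [ga [Uu0 Uu1 tri]]]]]] := coind_triangle hU (sval (irepr X)).
  rewrite (dual_coind Uu0 Uu1 tri) (_ : limg _ = 0%VS).
    by rewrite dimv0 sub0r oppr_le0 ler0n.
  apply/eqP; rewrite -subv0; apply/subvP => _ /memv_imgP[a _ ->].
  rewrite lfunE /= memv0; apply/eqP/factors_d_comp => //; exact: (svalP (irepr X)).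
(* The value at the index of [w] is 1, contradicting [c0]. *)
have := c0 (ind T (sval (irepr X0))); rewrite (cvectorE hKS hT hU) /=.
rewrite (coind_hom_ind hKS hT hU (svalP (irepr X0))) (K0_cls_irepr hKS).
by rewrite -/(K0_gen_dual X0 _) K0_gen_dualE eqxx.
Qed.

End Exchange.

Theorem theorem1p3 (k : closedFieldType) (C : triangulated_category k)
    (hKS : krull_schmidt C) (hCY : calabi_yau2 C)
    (T U : set C) (hT : cluster_tilting T) (hU : cluster_tilting U)
    (u : C) (Uu : U u) (iu : indecomposable u) :
  cvector T (indec_cls Uu iu)
    =1 K0_gen_dual (indec_cls Uu iu) \o (coind_hom U \o K0_incl T) /\
  ((forall V : set C, cluster_tilting V -> no_loops V /\ no_2cycles V) ->
   forall (u' e : C) (f : mor u' e) (g : mor e u) (d : mor u (Sg C u')),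
   is_mutation U u u' -> exchange_triangle U f g d ->
   (positive (cvector T (indec_cls Uu iu))
      <-> ~ factors_through (shifts T) d) /\
   (positive (cvector T (indec_cls Uu iu)) ->
    cvector T (indec_cls Uu iu) =1 dimvec (timage (yoneda_map T d)))).
Proof.
split=> [|hloop u' e f g d hmut hex]; first exact: cvectorE.
have [loopU _] := hloop U hU.
have posN : positive (cvector T (indec_cls Uu iu)) -> ~ factors_through (shifts T) d.
  by move=> pos fd; exact: (cvector_not_positive hKS hT hU loopU hmut hex fd pos).
have image := cvector_image hKS hCY hT hU loopU Uu iu hmut hex.
split=> [|/posN/image//]; split=> // nf X.
by rewrite image // [X in _ <= X]K0_eval_gen ler0n.
Qed.
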